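(* Let $\mathbb{F}$ be a field of characteristic $2$ with $q$ elements ($q$ finite). Let $M=M_2(\mathbb{F})$ with the $\mathbb{Z}_2$-grading $$M_0=\begin{pmatrix}\mathbb{F}&0\\0&\mathbb{F}\end{pmatrix},\qquad M_1=\begin{pmatrix}0&\mathbb{F}\\ \mathbb{F}&0\end{pmatrix}.$$ Then the ideal of $\mathbb{Z}_2$-graded polynomial identities of $M$ is generated, as a $T_{\mathbb{Z}_2}$-ideal, by the polynomials $$y_1^{q}-y_1$$ and $$(X_1-X_1^{q})(X_2-X_2^{q^2})(1-[X_1,X_2]^{q-1}),\qquad X_i=z_i+y_i\ (i=1,2),$$ where $y_i$ are indeterminates of degree $0$ and $z_i$ are indeterminates of degree $1$.
   Context: Algebras are associative and not necessarily unital. For a group $G$, a $G$-graded $\mathbb{F}$-algebra is an algebra $A=\bigoplus_{g\in G}A_g$ (direct sum of subspaces) with $A_gA_h\subseteq A_{gh}$. $\mathbb{F}\langle X_G\rangle$ is the free $G$-graded associative algebra (without unit) on the disjoint union of the countable sets $X_g=\{x_{i,g}\mid i\ge 1\}$, $g\in G$, where $x_{i,g}$ has degree $g$. A polynomial $f(x_{1,g_1},\dots,x_{n,g_n})$ is a graded polynomial identity of $A$ if $f(a_1,\dots,a_n)=0$ for all $a_i\in A_{g_i}$. The set $Id_G(A)$ of graded identities of $A$ is a $T_G$-ideal, i.e. a two-sided ideal invariant under all graded endomorphisms of $\mathbb{F}\langle X_G\rangle$. The $T_G$-ideal generated by a set $S$ is the smallest $T_G$-ideal containing $S$. Here $G=\mathbb{Z}_2$,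 $y_i=x_{i,0}$, $z_i=x_{i,1}$, and $[a,b]=ab-ba$. The expression $u(1-v)$ means $u-uv$. *)

(* Defs.v *)
From HB Require Import structures.
#[warnings="-all"] From mathcomp Require Import all_boot all_order all_algebra finmap.
#[warnings="-all"] From mathcomp Require Export monalg.

Set Implicit Arguments.
Unset Strict Implicit.
Unset Printing Implicit Defensive.

Import GRing.Theory.
Local Open Scope ring_scope.

(* G-graded algebras, for a finite abelian group G written additively.  The
   matrix algebra below happens to be unital; the notion does not use 1. *)
Record grading (F : fieldType) (G : finZmodType) (A : algType F) := Grading {
  component : G -> {pred A};
  component_submod : forall g, submod_closed (component g);
  component_direct : forall a : A, exists! c : {ffun G -> A},
    (forall g, c g \in component g) /\ a = \sum_g c g;
  component_mul : forall g h a b,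
    a \in component g -> b \in component h -> a * b \in component (g + h)
}.

Section FreeGradedAlgebra.
Variables (F : fieldType) (G : finZmodType).

(* The pair (i, g) stands for x_{i+1,g}: indices are shifted to start at 0. *)
Definition gvar : choiceType := (nat * G)%type.

(* The free unital algebra on the variables, i.e. the algebra of the free
   monoid of words.  F<X_G> itself, which has no unit, is its ideal [freealg]
   of polynomials without constant term. *)
Definition freealg1 := {malg F[{fmonom gvar}]}.

Definition freealg : {pred freealg1} := [pred p : freealg1 | mcoeff (mone : {fmonom gvar}) p == 0].

Definition xvar (i : nat) (g : G) : freealg1 := << fmu ((i, g) : gvar) >>.

Definition wdeg (m : {fmonom gvar}) : G := \sum_(v <- (m : seq gvar)) v.2.

Definition freecomp (g : G) : {pred freealg1} :=
  [pred p : freealg1 | (p \in freealg) && all (fun m => wdeg m == g) (msupp p)].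

(* Graded endomorphisms of F<X_G>; the values of phi outside [freealg] are
   irrelevant. *)
Record graded_endo (phi : freealg1 -> freealg1) : Prop := GradedEndo {
  endo_lin : forall c, {in freealg &, forall p r,
    phi (c *: p + r) = c *: phi p + phi r};
  endo_mul : {in freealg &, forall p r, phi (p * r) = phi p * phi r};
  endo_freealg : {in freealg, forall p, phi p \in freealg};
  endo_graded : forall g, {in freecomp g, forall p, phi p \in freecomp g}
}.

(* Ideals of an algebra without unit are required to be subspaces. *)
Record TGideal (I : freealg1 -> Prop) : Prop := TGIdeal {
  TGideal_sub : forall p, I p -> p \in freealg;
  TGideal0 : I 0;
  TGideal_lin : forall c p r, I p -> I r -> I (c *: p + r);
  TGideal_mull : forall p r, p \in freealg -> I r -> I (p * r);
  TGideal_mulr : forall p r, I p -> r \in freealg -> I (p * r);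
  TGideal_endo : forall phi p, graded_endo phi -> I p -> I (phi p)
}.

(* For S contained in [freealg]. *)
Definition TGgenerated (S : freealg1 -> Prop) (p : freealg1) : Prop :=
  forall I, TGideal I -> (forall s, S s -> I s) -> I p.

Definition geval (A : algType F) (a : gvar -> A) (p : freealg1) : A :=
  mmap (in_alg A) (fun m : {fmonom gvar} => \prod_(v <- (m : seq gvar)) a v) p.

Definition graded_identity (A : algType F) (gr : grading G A) (p : freealg1) :
  Prop :=
  p \in freealg /\
  forall a : gvar -> A, (forall v, a v \in component gr v.2) -> geval a p = 0.

End FreeGradedAlgebra.

Section Matrix2.
Variable F : fieldType.

Definition M2comp (g : 'Z_2) : {pred 'M[F]_2} :=
  if g == 0 then [pred a : 'M[F]_2 | (a 0 1 == 0) && (a 1 0 == 0)]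
  else [pred a : 'M[F]_2 | (a 0 0 == 0) && (a 1 1 == 0)].

Lemma ord2_cases (i : 'I_2) : i = 0 \/ i = 1.
Proof. by case: i => [[|[|k]]] //= h; [left | right]; apply: val_inj. Qed.

Lemma M2comp_submod g : submod_closed (M2comp g).
Proof.
rewrite /M2comp; case: (g == 0); split=> [|c a b]; rewrite !inE !mxE ?eqxx //.
all: by move=> /andP[/eqP-> /eqP->] /andP[/eqP-> /eqP->];
  rewrite !mulr0 !addr0 eqxx.
Qed.

Lemma M2comp_direct (a : 'M[F]_2) : exists! c : {ffun 'Z_2 -> 'M[F]_2},
  (forall g, c g \in M2comp g) /\ a = \sum_g c g.
Proof.
exists [ffun g : 'Z_2 => \matrix_(i, j) (if g == i + j then a i j else 0)].
split=> [|c [c_in ->]].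
  split=> [g|].
    rewrite ffunE /M2comp.
    by case: (ord2_cases g) => -> /=; rewrite inE !mxE /= !eqxx.
  apply/matrixP => i j; rewrite summxE (bigD1 (i + j)) //= ffunE mxE eqxx.
  by rewrite big1 ?addr0 // => g /negPf ne; rewrite ffunE mxE ne.
apply/ffunP => g; rewrite ffunE; apply/matrixP => i j; rewrite mxE summxE.
have c0 h : h != i + j -> c h i j = 0.
  move: (c_in h); rewrite /M2comp.
  by case: (ord2_cases h) => ->; case: (ord2_cases i) => ->;
    case: (ord2_cases j) => -> //= /andP[/eqP ? /eqP ?].
case: ifP => [/eqP g_ij|/negbT ne]; last by rewrite (c0 g ne).
rewrite {}g_ij (bigD1 (i + j)) //= big1 ?addr0 // => h ne; exact: c0.
Qed.

Lemma M2comp_mul g h a b :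
  a \in M2comp g -> b \in M2comp h -> a * b \in M2comp (g + h).
Proof.
rewrite /M2comp.
case: (ord2_cases g) => ->; case: (ord2_cases h) => -> /=; rewrite !inE.
all: move=> /andP[/eqP a1 /eqP a2] /andP[/eqP b1 /eqP b2].
all: rewrite !mxE !big_ord_recl !big_ord0.
all: have -> : lift ord0 (ord0 : 'I_1) = 1 :> 'I_2 by exact: val_inj.
all: have -> : ord0 = 0 :> 'I_2 by exact: val_inj.
all: by rewrite ?a1 ?a2 ?b1 ?b2 !(mulr0, mul0r, addr0) eqxx.
Qed.

Definition M2grading : grading 'Z_2 'M[F]_2 :=
  Grading M2comp_submod M2comp_direct M2comp_mul.

Definition yvar (i : nat) : freealg1 F 'Z_2 := xvar F i (0 : 'Z_2).
Definition zvar (i : nat) : freealg1 F 'Z_2 := xvar F i (1 : 'Z_2).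
Definition Xvar (i : nat) := zvar i + yvar i.

Definition lie_bracket (R : pzRingType) (a b : R) := a * b - b * a.

Definition id_even (q : nat) := yvar 0%N ^+ q - yvar 0%N.

(* u(1 - v) is read as u - uv, the free algebra having no unit. *)
Definition id_full (q : nat) :=
  let u := (Xvar 0%N - Xvar 0%N ^+ q) * (Xvar 1%N - Xvar 1%N ^+ (q ^ 2)) in
  u - u * lie_bracket (Xvar 0%N) (Xvar 1%N) ^+ (q - 1).

End Matrix2.

(* Main.v *)
Require Import Defs.
From mathcomp Require Import all_boot all_order all_algebra.
From mathcomp Require Import all_solvable all_field finmap ring zify.

(* Only y^q - y is needed to derive every identity of M.  In an algebra with
   these identities the even part satisfies x^q = x; after adjoining scalars,
   x is a linear combination of the idempotents (x - c)^(q-1), which are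
   central because the ring is reduced, so the even part is commutative.
   Together with x^q = x this forces u v w = w v u for odd u, v, w: each of
   (u v)^(q-1) and (w v)^(q-1) identifies the two sides on multiplication, and
   they fix u v w and w v u respectively.  Hence a word is
   determined by the monomial obtained when it is evaluated at generic
   matrices, each letter being recorded with the row (its "state") at which it
   is read.  Adding q - 1 copies of an even letter, or of a pair of odd letters
   read at different rows, does not change a word already containing them, so
   words inducing the same function on matrices agree.  As distinct monomial
   functions are multiplicative characters, they are linearly independent.
   Conversely, a 2x2 matrix X over F with nonzero trace satisfies
   X^(q^2) = X, while X - X^(q^2) is nilpotent of rank at most 1 if the trace
   is 0; this gives the second identity. *)

Set Implicit Arguments.
Unset Strict Implicit.
Unset Printing Implicit Defensive.

Import GRing.Theory.
Local Open Scope ring_scope.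

(** * Evaluation of words and graded endomorphisms *)

Section Words.
Variables (F : fieldType) (G : finZmodType).
Local Notation A := (freealg1 F G).
Local Notation word := (seq (gvar G)).

Definition mon (w : word) : A := << FMonom w >>.

Lemma mon_nil : mon [::] = 1.
Proof. by rewrite /mon -fmoneE. Qed.

Lemma mon_cat u v : mon (u ++ v) = mon u * mon v.
Proof. by rewrite /mon malgM_def fgmulUU mulr1 -[mmul _ _]/(fmmul _ _) fmmulE.
  Qed.

Lemma mon_xvar v : mon [:: v] = xvar F v.1 v.2.
Proof. by rewrite /mon /xvar fmuE; case: v. Qed.

Lemma mon_sum (p : A) : p = \sum_(m <- msupp p) p@_m *: mon m.
Proof.
rewrite {1}[p]monalgE; apply: eq_bigr => m _; apply/malgP => k.
by rewrite mcoeffZ !mcoeffU fmK mulr_natr.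
Qed.

Lemma scale_mon c w : c *: mon w = << c *g FMonom w >>.
Proof. by apply/malgP => k; rewrite mcoeffZ /mon !mcoeffU mulrnAr mulr1. Qed.

(** On monomials this is commutativity of [F]; bilinearity gives the rest. It supplies the
    hypothesis [scaleSr] of later sections when the target is the free algebra itself. *)
Lemma malg_scaleAr c (p r : A) : c *: (p * r) = p * (c *: r).
Proof.
have monr d u v : mon u * (d *: mon v) = d *: (mon u * mon v).
  rewrite -mon_cat !scale_mon malgM_def fgmulUU mul1r.
  by rewrite -[mmul _ _]/(fmmul _ _) fmmulE.
have mon_scale u : c *: (mon u * r) = mon u * (c *: r).
  rewrite (mon_sum r) mulr_sumr !scaler_sumr mulr_sumr.
  by apply: eq_bigr => n _; rewrite scalerA !monr scalerA.
rewrite (mon_sum p) !mulr_suml scaler_sumr; apply: eq_bigr => m _.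
by rewrite -!scalerAl -mon_scale !scalerA mulrC.
Qed.
End Words.

Section Eval.
Variables (F : fieldType) (G : finZmodType) (S : lalgType F).
Local Notation A := (freealg1 F G).
Local Notation word := (seq (gvar G)).
Hypothesis scaleSr : forall c (x y : S), c *: (x * y) = x * (c *: y).

Definition weval (a : gvar G -> S) (w : word) : S := \prod_(v <- w) a v.
(** The same map as [geval], stated for targets that include the free algebra, so that substituting
    polynomials for variables is also an evaluation. *)
Definition peval (a : gvar G -> S) (p : A) : S :=
  \sum_(m <- msupp p) p@_m *: weval a m.

Lemma weval_cat a u v : weval a (u ++ v) = weval a u * weval a v.
Proof. exact: big_cat. Qed.

Lemma peval_mmap a p : peval a p = mmap (in_alg S) (fun m :
  {fmonom gvar G} => weval a m) p.
Proof. by rewrite mmapE; apply: eq_bigr => m _; rewrite mulr_algl. Qed.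

Lemma pevalZ a c (p : A) : peval a (c *: p) = c *: peval a p.
Proof.
rewrite peval_mmap (mmapEw (msuppZ_le _ _)) scaler_sumr.
by apply: eq_bigr => m _; rewrite mcoeffZ mulr_algl scalerA.
Qed.

Lemma pevalD a (p r : A) : peval a (p + r) = peval a p + peval a r.
Proof. by rewrite !peval_mmap mmapD. Qed.

Lemma peval_linear a c (p r : A) :
  peval a (c *: p + r) = c *: peval a p + peval a r.
Proof. by rewrite pevalD pevalZ. Qed.

Lemma peval_sum a (I : Type) (r : seq I) (c : I -> F) (f : I -> A) :
  peval a (\sum_(i <- r) c i *: f i) = \sum_(i <- r) c i *: peval a (f i).
Proof.
elim: r => [|i r IH]; first by rewrite !big_nil peval_mmap mmap0.
by rewrite !big_cons peval_linear IH.
Qed.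

Lemma peval_mon a w : peval a (mon F w) = weval a w.
Proof. by rewrite /peval msuppU1 big_seq_fset1 mcoeffU1 eqxx scale1r. Qed.

Lemma pevalM a p r : peval a (p * r) = peval a p * peval a r.
Proof.
rewrite {1}[p]mon_sum big_distrl /=.
under eq_bigr do rewrite -scalerAl.
rewrite peval_sum [in RHS]/peval big_distrl /=.
apply: eq_bigr => m _; rewrite -scalerAl; congr (_ *: _).
rewrite {1}[r]mon_sum big_distrr /=.
under eq_bigr do rewrite -malg_scaleAr -mon_cat.
rewrite peval_sum big_distrr /=.
by apply: eq_bigr => n _; rewrite -scaleSr peval_mon weval_cat.
Qed.

Lemma peval_xvar a i g : peval a (xvar F i g) = a (i, g).
Proof. by rewrite -(mon_xvar F (i, g)) peval_mon /weval big_seq1. Qed.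

Lemma peval1 a : peval a 1 = 1.
Proof. by rewrite -mon_nil peval_mon /weval big_nil. Qed.

Lemma pevalX a p n : peval a (p ^+ n) = peval a p ^+ n.
Proof. by elim: n => [|n IH]; rewrite ?peval1 // !exprS pevalM IH. Qed.

Lemma pevalB a p r : peval a (p - r) = peval a p - peval a r.
Proof. by rewrite addrC -scaleN1r peval_linear scaleN1r addrC. Qed.
End Eval.

(** * Homogeneous components and graded endomorphisms of the free algebra *)

Section FreeAlg.
Variables (F : fieldType) (G : finZmodType).
Local Notation fa := (@freealg F G).
Local Notation A := (freealg1 F G).
Local Notation word := (seq (gvar G)).

Lemma wdeg_cat (u v : word) :
  wdeg (FMonom (u ++ v)) = wdeg (FMonom u) + wdeg (FMonom v).
Proof. exact: big_cat. Qed.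

Lemma mon_freealg (w : word) : (mon F w \in fa) = (w != [::]).
Proof. by rewrite inE mcoeffU1 -[mone]/(fmone _) fmoneE fmP; case: (w == [::]);
  rewrite ?eqxx ?oner_eq0. Qed.

Lemma mon_freecomp (w : word) g :
  (mon F w \in @freecomp F G g) = (w != [::]) && (wdeg (FMonom w) == g).
Proof.
rewrite inE mon_freealg msuppU1; congr (_ && _).
apply/allP/idP => [-> //|/eqP <- m]; first exact: fset11.
by rewrite in_fset1 => /eqP->.
Qed.

Lemma freealg_lin c (p r : A) : p \in fa ->
   r \in fa -> c *: p + r \in fa.
Proof.
by rewrite !inE mcoeffD mcoeffZ => /eqP-> /eqP->; rewrite mulr0 addr0.
Qed.

Lemma freecompP g (p : A) : reflect (forall m, p@_m != 0 ->
  m != mone /\ wdeg m = g) (p \in @freecomp F G g).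
Proof.
apply: (iffP andP) => [[/eqP p1 /allP hp] m pm|hp].
  split; last by apply/eqP/hp; rewrite -mcoeff_neq0.
  by apply: contraNneq pm => ->; apply/eqP.
split; first by apply/negP => /negP/hp [/eqP].
by apply/allP => m; rewrite -mcoeff_neq0 => /hp [_ ->].
Qed.

Lemma freecomp_lin g c (p r : A) : p \in @freecomp F G g -> r \in @freecomp F G
  g ->
  c *: p + r \in @freecomp F G g.
Proof.
move=> /freecompP hp /freecompP hr; apply/freecompP => m.
have [pm|pm] := eqVneq (p@_m) 0; last by move=> _; exact: hp.
by rewrite mcoeffD mcoeffZ pm mulr0 add0r; exact: hr.
Qed.

Lemma freecomp_freealg g (p : A) : p \in @freecomp F G g -> p \in fa.
Proof. by case/andP. Qed.

Lemma freecomp0 g : 0 \in @freecomp F G g.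
Proof. by apply/freecompP => m; rewrite mcoeff0 eqxx. Qed.

Lemma freecomp_sum g (I : eqType) (s : seq I) (c : I -> F) (f : I -> A) :
  (forall i, i \in s -> f i \in @freecomp F G g) ->
  \sum_(i <- s) c i *: f i \in @freecomp F G g.
Proof.
move=> hf; rewrite big_seq; elim/big_rec: _ => [|i p i_s hp];
  first exact: freecomp0.
by apply: freecomp_lin => //; exact: hf.
Qed.

Lemma freecompM g h (p r : A) : p \in @freecomp F G g -> r \in @freecomp F G h
  ->
  p * r \in @freecomp F G (g + h).
Proof.
move=> /freecompP hp /freecompP hr.
rewrite (mon_sum p) big_distrl /=.
under eq_bigr do rewrite -scalerAl.
apply: freecomp_sum => m; rewrite -mcoeff_neq0 => /hp [m1 <-].
rewrite {1}(mon_sum r) big_distrr /=.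
under eq_bigr do rewrite -malg_scaleAr -mon_cat.
apply: freecomp_sum => n; rewrite -mcoeff_neq0 => /hr [n1 <-].
rewrite mon_freecomp wdeg_cat !fmK eqxx andbT.
apply: contra_neq m1 => mn; rewrite -[m]fmK -[mone]/(fmone _) fmoneE.
by case: (m : seq _) mn.
Qed.

Lemma freealg0 : 0 \in fa.
Proof. by rewrite inE mcoeff0. Qed.

Lemma freealg_sum (I : eqType) (s : seq I) (c : I -> F) (f : I -> A) :
  (forall i, i \in s -> f i \in fa) -> \sum_(i <- s) c i *: f i \in fa.
Proof.
move=> hf; rewrite big_seq; elim/big_rec: _ => [|i p i_s hp];
  first exact: freealg0.
by apply: freealg_lin => //; exact: hf.
Qed.

Lemma freealg_msupp (p : A) m : p \in fa -> m \in msupp p -> (m :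
  seq _) != [::].
Proof.
rewrite inE => /eqP p1; rewrite -mcoeff_neq0; apply: contra_neq => m0.
by rewrite -[m]fmK m0 -fmoneE.
Qed.

Lemma freealgMr (p r : A) : p \in fa -> p * r \in fa.
Proof.
move=> hp; rewrite (mon_sum p) big_distrl /=.
under eq_bigr do rewrite -scalerAl.
apply: freealg_sum => m mp.
rewrite {1}(mon_sum r) big_distrr /=.
under eq_bigr do rewrite -malg_scaleAr -mon_cat.
apply: freealg_sum => n _; rewrite mon_freealg.
by case: (m : seq _) (freealg_msupp hp mp).
Qed.

Lemma xvar_freecomp i g : xvar F i g \in @freecomp F G g.
Proof.
by rewrite -(mon_xvar F (i, g)) mon_freecomp /wdeg big_seq1 eqxx.
Qed.

Lemma freealgX (p : A) n : p \in fa -> (0 < n)%N -> p ^+ n \in fa.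
Proof. by case: n => // n hp _; rewrite exprS freealgMr. Qed.

Lemma subst_endo (a : gvar G -> A) : (forall v, a v \in @freecomp F G v.2) ->
  graded_endo (peval a).
Proof.
move=> ha.
(* The induction starts from a single letter: the empty word evaluates to 1, which lies outside
   [freealg]. *)
have wa w : w != [::] -> weval a w \in @freecomp F G (wdeg (FMonom w)).
  elim: w => // v [|u w] IH _; first by rewrite /weval /wdeg !big_seq1.
  rewrite -cat1s weval_cat wdeg_cat; apply: freecompM; last exact: IH.
  by rewrite /weval /wdeg !big_seq1.
split.
- by move=> c p r _ _; exact: peval_linear.
- by move=> p r _ _; apply: pevalM; exact: malg_scaleAr.
- move=> p hp; apply: freealg_sum => m /(freealg_msupp hp) m1.
  exact: freecomp_freealg (wa _ m1).
- move=> g p hp; apply: freecomp_sum => m mp.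
  have /freecompP/(_ m) := hp; rewrite mcoeff_neq0 => /(_ mp) [_ <-].
  by rewrite -{2}[m]fmK; apply: wa; apply: freealg_msupp mp;
    exact: freecomp_freealg hp.
Qed.

Lemma endo_weval (phi : A -> A) : graded_endo phi -> forall w, w != [::] ->
  phi (mon F w) = weval (fun v => phi (xvar F v.1 v.2)) w.
Proof.
move=> hphi; set a := fun v : gvar G => _; elim=> // v [|u w] IH _.
  by rewrite mon_xvar /weval big_seq1.
have -> : mon F [:: v, u & w] = xvar F v.1 v.2 * mon F (u :: w).
  by rewrite -mon_xvar -mon_cat.
have -> : weval a [:: v, u & w] = a v * weval a (u :: w) by exact: big_cons.
rewrite -(IH isT) (endo_mul hphi) // ?mon_freealg //.
exact: freecomp_freealg (xvar_freecomp _ _).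
Qed.

Lemma endo0 (phi : A -> A) : graded_endo phi -> phi 0 = 0.
Proof.
move=> hphi; have := endo_lin hphi (-1) freealg0 freealg0.
by rewrite scaleN1r oppr0 addr0 scaleN1r addNr.
Qed.

Lemma endo_peval (phi : A -> A) (p : A) : graded_endo phi -> p \in fa ->
  phi p = peval (fun v => phi (xvar F v.1 v.2)) p.
Proof.
move=> hphi hp; rewrite {1}(mon_sum p) /peval.
have: forall m, m \in enum_fset (msupp p) -> (m : seq _) != [::].
  by move=> m; exact: freealg_msupp hp.
move: (enum_fset (msupp p)) => s hs.
(* Membership of the partial sums in [freealg] is carried through the induction, because [phi] is
   known to be linear only there. *)
suff [] : phi (\sum_(m <- s) p@_m *: mon F m) =
  \sum_(m <- s) p@_m *: weval (fun v : gvar G => phi (xvar F v.1 v.2)) m /\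
  \sum_(m <- s) p@_m *: mon F m \in fa by [].
elim: s hs => [|m s IH] hs; first by rewrite !big_nil endo0 // freealg0.
have [|IH1 IH2] := IH; first by move=> n ns; apply: hs; rewrite in_cons ns orbT.
have m1 : (m : seq _) != [::] by apply: hs; exact: mem_head.
rewrite !big_cons (endo_lin hphi) ?mon_freealg // IH1 endo_weval //.
by split=> //; apply: freealg_lin => //; rewrite mon_freealg.
Qed.
End FreeAlg.

(** * The graded identities of an algebra form a T-ideal *)

Section Identities.
Variables (F : fieldType) (G : finZmodType) (A : algType F) (gr : grading G A).

Lemma geval_peval (a : gvar G -> A) (p : freealg1 F G) : geval a p = peval a p.
Proof. by rewrite peval_mmap. Qed.

Lemma algS c (x y : A) : c *: (x * y) = x * (c *: y).
Proof. by rewrite scalerAr. Qed.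

Lemma weval_component (a : gvar G -> A) w :
  (forall v, a v \in component gr v.2) ->
  w != [::] -> weval a w \in component gr (wdeg (FMonom w)).
Proof.
move=> ha; elim: w => // v [|u w] IH _; first by rewrite /weval /wdeg !big_seq1.
rewrite -cat1s weval_cat wdeg_cat; apply: component_mul; last exact: IH.
by rewrite /weval /wdeg !big_seq1.
Qed.

Lemma peval_component (a : gvar G -> A) g p :
  (forall v, a v \in component gr v.2) ->
  p \in freecomp g -> peval a p \in component gr g.
Proof.
move=> ha hp; have [h0 hl] := component_submod gr g.
rewrite /peval big_seq; elim/big_rec: _ => // m x mp hx; apply: hl => //.
have /freecompP/(_ m) := hp; rewrite mcoeff_neq0 => /(_ mp) [_ <-].
rewrite -{2}[m]fmK; apply: weval_component => //; apply: freealg_msupp mp.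
exact: freecomp_freealg hp.
Qed.

Lemma graded_identity_TGideal : TGideal (graded_identity gr).
Proof.
have ev := geval_peval; split.
- by move=> p [].
- by split=> [|a _]; rewrite ?freealg0 // ev peval_mmap mmap0.
- move=> c p r [hp ip] [hr ir]; split=> [|a ha]; first exact: freealg_lin.
  by rewrite ev peval_linear -!ev ip // ir // scaler0 addr0.
- move=> p r hp [hr ir]; split=> [|a ha]; first exact: freealgMr.
  by rewrite ev pevalM -?ev ?ir ?mulr0 //; exact: algS.
- move=> p r [hp ip] hr; split=> [|a ha]; first exact: freealgMr.
  by rewrite ev pevalM -?ev ?ip ?mul0r //; exact: algS.
- move=> phi p hphi [hp ip]; split=> [|a ha]; first exact: (endo_freealg hphi).
  (* Evaluating [phi p] at [a] is evaluating [p] at [b], and [b v] has the degree of [v] because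
     [phi] is graded. *)
  pose b v := peval a (phi (xvar F v.1 v.2)).
  have hb v : b v \in component gr v.2.
    apply: peval_component => //; apply: (endo_graded hphi);
      exact: xvar_freecomp.
  rewrite -(ip b hb) !ev (endo_peval hphi hp).
  rewrite [X in peval a X]/peval peval_sum [RHS]/peval; apply: eq_bigr => m _;
    congr (_ *: _).
  elim: (m : seq _) => [|v w IH]; first by rewrite /weval !big_nil peval1.
  rewrite -cat1s !weval_cat pevalM ?IH; last exact: algS.
  by rewrite /weval !big_seq1.
Qed.
End Identities.

(** * Identities of 2x2 matrices in characteristic 2 *)

Section Matrix2Lemmas.
Variable F : fieldType.
Implicit Types (A B X N : 'M[F]_2).

Lemma mulmx2E A B i j : (A * B) i j = A i 0 * B 0 j + A i 1 * B 1 j.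
Proof.
rewrite mxE !big_ord_recl big_ord0 addr0.
by have -> : lift ord0 (ord0 : 'I_1) = 1 :> 'I_2 by exact: val_inj.
Qed.

Lemma matrix2P A B : A 0 0 = B 0 0 -> A 0 1 = B 0 1 -> A 1 0 = B 1 0 ->
  A 1 1 = B 1 1 -> A = B.
Proof.
by move=> *; apply/matrixP => i j; case: (ord2_cases i) => ->;
  case: (ord2_cases j) => ->.
Qed.

(** Such an N has rank at most 1, say N = u v^T, so N X N = (v^T X u) N and the scalar is tr(N X).
    In coordinates only the (0,0) entry of N^2 = 0 is used. *)
Lemma mul_nilp2_l N X : N 1 1 = - N 0 0 -> N * N = 0 ->
  N * X * N = (\tr (N * X)) *: N.
Proof.
move=> N11 /matrixP/(_ 0 0); rewrite mulmx2E mxE addrC => /addr0_eq/esym NN.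
rewrite /mxtrace !big_ord_recl big_ord0 addr0.
have -> : lift ord0 (ord0 : 'I_1) = 1 :> 'I_2 by exact: val_inj.
have -> : ord0 = 0 :> 'I_2 by exact: val_inj.
by apply: matrix2P; rewrite !mulmx2E mxE ?N11; ring: NN.
Qed.

(** For nonzero N, N X N = tr(N X) N = 0 puts the columns of X N in the kernel of N, which is also
    its image, a line; X acts on this line by a scalar. *)
Lemma nilp2_eigen N X : N 1 1 = - N 0 0 -> N * N = 0 -> \tr (N * X) = 0 ->
  exists a, X * N = a *: N.
Proof.
move=> N11 /matrixP/(_ 0 0); rewrite mulmx2E mxE addrC => /addr0_eq/esym NN.
rewrite /mxtrace !big_ord_recl big_ord0 addr0.
have -> : lift ord0 (ord0 : 'I_1) = 1 :> 'I_2 by exact: val_inj.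
have -> : ord0 = 0 :> 'I_2 by exact: val_inj.
rewrite !mulmx2E N11 => tr0.
have [c0|c0] := eqVneq (N 1 0) 0; last first.
  (* The first column of N spans the image; the scalar compares its second coordinate before and
     after applying X. *)
  exists ((X 1 0 * N 0 0 + X 1 1 * N 1 0) / N 1 0).
  set d := _ / _; have dE : d * N 1 0 = X 1 0 * N 0 0 + X 1 1 * N 1 0 by exact:
    divfK.
  move/eqP: (dE); rewrite -subr_eq0 => /eqP hd.
  (* The three vanishing relations are N^2 = 0, the trace condition and the choice of [d]; each
     entry equation, times [N 1 0], is a combination of them. *)
  have lin u v w : u * (N 0 0 * N 0 0 + N 0 1 * N 1 0) +
     v * (N 0 0 * X 0 0 + N 0 1 * X 1 0 + (N 1 0 * X 0 1 + - N 0 0 * X 1 1)) +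
     w * (d * N 1 0 - (X 1 0 * N 0 0 + X 1 1 * N 1 0)) = 0.
    by rewrite tr0 NN hd; ring.
  apply: matrix2P; apply: (mulIf c0); rewrite !mulmx2E mxE ?N11;
    apply: subr0_eq.
  - by rewrite -(lin (- X 1 0) (N 1 0) (- N 0 0)); ring.
  - by rewrite -(lin (X 0 0 - X 1 1) (- N 0 0) (- N 0 1)); ring.
  - by rewrite -(lin 0 0 (- N 1 0)); ring.
  - by rewrite -(lin (X 1 0) 0 (N 0 0)); ring.
have a0 : N 0 0 = 0.
  by move: NN; rewrite c0 mulr0 oppr0 => /eqP; rewrite mulf_eq0 orbb => /eqP.
have [b0|b0] := eqVneq (N 0 1) 0.
  exists 0; rewrite scale0r; apply: matrix2P;
  by rewrite !mulmx2E ?N11 ?a0 ?b0 ?c0 mxE; ring.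
(* Only the entry [N 0 1] is nonzero, and the trace condition forces [X 1 0] = 0: the first basis
   vector is an eigenvector of X. *)
exists (X 0 0); apply: matrix2P; rewrite !mulmx2E mxE ?N11 ?a0 ?c0; try ring.
move: tr0; rewrite a0 c0 !(mul0r, oppr0, addr0, add0r) => /eqP.
rewrite mulf_eq0 (negPf b0) /= => /eqP ->; ring.
Qed.

Hypothesis char2 : 2%N \in [pchar F].

Lemma add_self2 (x : F) : x + x = 0.
Proof. exact: addrr_pchar2. Qed.

(** With t the trace, Cayley-Hamilton in characteristic 2 gives X^2 = t X + det X. Squaring a X + s
    kills the cross term and turns the coefficient a into a^2 t, whence t^(2^k - 1). *)
Lemma mx2_frobenius X k : exists s,
  X ^+ (2 ^ k) = (X 0 0 + X 1 1) ^+ (2 ^ k - 1) *: X + s%:M.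
Proof.
have two0 := pcharf0 char2.
elim: k => [|k [s IH]]; first by exists 0; rewrite expr1 scale1r raddf0 addr0.
pose t := X 0 0 + X 1 1; pose a := t ^+ (2 ^ k - 1).
exists (a ^+ 2 * (X 0 0 * X 1 1 + X 0 1 * X 1 0) + s ^+ 2).
rewrite expnSr exprM IH -/t.
have -> : t ^+ (2 ^ k * 2 - 1) = a ^+ 2 * t.
  rewrite -exprM -exprSr; congr (_ ^+ _).
  by have := expn_gt0 2 k; lia.
rewrite -/a; move: a => a.
rewrite expr2; apply: matrix2P; rewrite !mulmx2E !mxE /= /t; ring: two0.
Qed.
End Matrix2Lemmas.

(** * The two generating polynomials vanish on matrices *)

Section FullIdentity.
Variables (F : finFieldType) (char2 : (2%N \in [pchar F])%R).
Implicit Types (X : 'M[F]_2).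

Lemma card_pow2 : exists2 e, (0 < e)%N & #|F| = (2 ^ e)%N.
Proof.
have h := card_pprimeChar char2; eexists; last exact: h.
rewrite lt0n; apply: contra_eq_neq h => /= ->; rewrite expn0.
by have := finRing_gt1 F; case: #|F| => [|[]].
Qed.

Lemma expX_addM X (s : F) : (X + s%:M) ^+ #|F| = X ^+ #|F| + s%:M.
Proof.
rewrite -{2}[s]expf_card; have [e _ ->] := card_pow2.
elim: e => [|e IH]; first by rewrite !expr1.
rewrite expnSr !exprM IH; set Y := X ^+ _; set t := s ^+ _.
have comm : Y * t%:M = t%:M * Y by exact: scalar_mxC.
rewrite [LHS]expr2 mulrDl !mulrDr comm addrA -[_ + _ + t%:M * Y]addrA -mulr2n.
rewrite -[(t%:M * Y) *+ 2]scaler_nat pcharf0 // scale0r addr0 -expr2;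
  congr (_ + _).
by rewrite -[t ^+ 2]/(t * t) -[LHS]/(_ *m _) -scalar_mxM.
Qed.

(** If the trace t is nonzero, t^(q-1) = 1, so X^q = X + s and X^(q^2) = X + s + s = X. If t = 0,
    X^(q^2) is a scalar s; then N = X - s has trace 0, N^2 is a scalar c, and N^(q^2) = s + s = 0
    forces c = 0. *)
Lemma mx2_nilp X (N := X - X ^+ (#|F| ^ 2)) : N = 0 \/
  [/\ N 1 1 = - N 0 0, N * N = 0 & exists s, N = X - s%:M].
Proof.
have opp (x : F) : - x = x by apply: oppr_pchar2.
have [e e0 qE] := card_pow2.
have cE : (#|F| ^ 2 = 2 ^ (2 * e))%N by rewrite qE -expnM mulnC.
pose t := X 0 0 + X 1 1.
have [t0|t0] := eqVneq t 0; [right | left]; last first.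
  have [s] := mx2_frobenius char2 X e; rewrite -/t -qE.
  have -> : t ^+ (#|F| - 1) = 1.
    apply: (mulIf t0); rewrite -exprSr mul1r -[RHS]expf_card; congr (_ ^+ _).
    by rewrite subn1 prednK // (ltnW (finRing_gt1 F)).
  rewrite scale1r => Xq.
  rewrite /N expnS expn1 exprM Xq expX_addM Xq -addrA -raddfD /=.
  by rewrite add_self2 // raddf0 addr0 subrr.
have [s Xs] := mx2_frobenius char2 X (2 * e); move: Xs.
rewrite -/t t0 expr0n -cE.
have -> : (#|F| ^ 2 - 1 == 0)%N = false.
  by apply/negbTE; rewrite subn_eq0 -ltnNge -{1}(exp1n 2) ltn_exp2r //
    finRing_gt1.
rewrite scale0r add0r => Xs.
have NE : N = X - s%:M by rewrite /N Xs.
clearbody N.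
have X11 : X 1 1 = X 0 0 by rewrite -[LHS]opp; apply/eqP;
  rewrite eq_sym -subr_eq0 opprK; apply/eqP.
have N11 : N 1 1 = - N 0 0 by rewrite opp NE !mxE X11.
split=> //; last by exists s.
pose c := N 0 0 * N 0 0 + N 0 1 * N 1 0.
have NN : N * N = c%:M.
  by apply: matrix2P; rewrite !mulmx2E !mxE /= ?mulr1n ?mulr0n ?N11 /c; ring.
have : (N ^+ (#|F| ^ 2)) = 0.
  rewrite NE expnS expn1 exprM -scaleN1r.
  have -> : -1 *: s%:M = s%:M :> 'M[F]_2 by rewrite opp scale1r.
  by rewrite !expX_addM -exprM mulnn Xs -raddfD /= add_self2 // raddf0.
move=> /(congr1 (fun A => A * A)); rewrite mulr0 -expr2 exprAC expr2 NN.
have cX n : (c%:M : 'M[F]_2) ^+ n = (c ^+ n)%:M by rewrite -(rmorphXn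
  (@scalar_mx F 2)).
rewrite cX => /matrixP/(_ 0 0); rewrite !mxE /= mulr1n => /eqP.
by rewrite expf_eq0 => /andP[_ /eqP->]; rewrite raddf0.
Qed.

(** With N = X_2 - X_2^(q^2) and t = tr(N X_1), the equality [X_1, X_2] = [X_1, N] gives N
    [X_1, X_2]^(q-1) = t^(q-1) N. If t is nonzero this is N and the terms cancel; if t = 0, X_1 N =
    a N, so (X_1 - X_1^q) N = (a - a^q) N = 0. *)
Lemma M2_full X1 X2 :
  let u := (X1 - X1 ^+ #|F|) * (X2 - X2 ^+ (#|F| ^ 2)) in
  u - u * lie_bracket X1 X2 ^+ (#|F| - 1) = 0.
Proof.
have := mx2_nilp X2 => /=; set N := X2 - _; move=> [-> | [N11 NN [s NE]]].
  by rewrite mulr0 mul0r subr0.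
have brE : lie_bracket X1 X2 = X1 * N - N * X1.
  rewrite /lie_bracket NE mulrBr mulrBl opprB.
  have -> : s%:M * X1 = X1 * s%:M by symmetry; exact: scalar_mxC.
  by rewrite addrA subrK.
pose t := \tr (N * X1).
have NbN : N * lie_bracket X1 X2 = t *: N.
  by rewrite brE mulrBr !mulrA NN mul0r subr0 mul_nilp2_l.
have [t0|t0] := eqVneq t 0.
  have [a Xa] := nilp2_eigen N11 NN t0.
  have XaX n : X1 ^+ n * N = a ^+ n *: N.
    elim: n => [|n IH]; first by rewrite mul1r scale1r.
    by rewrite exprSr -mulrA Xa -scalerAr IH scalerA -exprS.
  by rewrite mulrBl XaX expf_card Xa subrr mul0r subrr.
have NbX n : N * lie_bracket X1 X2 ^+ n = t ^+ n *: N.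
  elim: n => [|n IH]; first by rewrite mulr1 scale1r.
  by rewrite exprSr mulrA IH -scalerAl NbN scalerA -exprSr.
rewrite -mulrA NbX.
have -> : t ^+ (#|F| - 1) = 1.
  apply: (mulIf t0); rewrite -exprSr mul1r -[RHS]expf_card; congr (_ ^+ _).
  by rewrite subn1 prednK // (ltnW (finRing_gt1 F)).
by rewrite scale1r subrr.
Qed.

Lemma M2_even (a : 'M[F]_2) : a \in M2comp (F := F) 0 -> a ^+ #|F| = a.
Proof.
rewrite /M2comp /= inE => /andP[/eqP a01 /eqP a10].
have aX n : a ^+ n.+1 = \matrix_(i, j) (if i == j then a i i ^+ n.+1 else 0).
  elim: n => [|n IH].
    by apply: matrix2P; rewrite !mxE ?expr1.
  by rewrite exprS IH; apply: matrix2P;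
    rewrite !mulmx2E !mxE /= ?a01 ?a10 !(mul0r, mulr0, addr0, add0r) -?exprS.
have [n qE] : exists n, #|F| = n.+1 by have := finRing_gt1 F;
  case: #|F| => // n; exists n.
rewrite qE aX -qE; apply: matrix2P; by rewrite !mxE /= ?expf_card.
Qed.
End FullIdentity.

(** * Commutativity from x^q = x *)

Section PowerIdentityCommutative.
Variables (F : finFieldType) (R : lalgType F).
Hypothesis scaleSr : forall c (x y : R), c *: (x * y) = x * (c *: y).
(** [J] is a two-sided ideal; congruences are taken modulo it without forming a quotient ring. *)
Variable J : R -> Prop.
Hypotheses (J0 : J 0) (J_lin : forall c x y, J x -> J y -> J (c *: x + y)).
Hypotheses (J_mull : forall x y, J y -> J (x * y)) (J_mulr : forall x y, J x ->
  J (x * y)).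
Local Notation "x ≡ y" := (J (x - y)) (at level 70).

Lemma J_add x y : J x -> J y -> J (x + y).
Proof. by rewrite -{2}[x]scale1r; exact: J_lin. Qed.

Lemma J_scale c x : J x -> J (c *: x).
Proof. by rewrite -[c *: x]addr0 => hx; exact: J_lin. Qed.

Lemma cong_refl x : x ≡ x. Proof. by rewrite subrr. Qed.

Lemma cong_sym x y : x ≡ y -> y ≡ x.
Proof. by move/(J_scale (-1)); rewrite scaleN1r opprB. Qed.

Lemma cong_trans y x z : x ≡ y -> y ≡ z -> x ≡ z.
Proof. by move=> xy yz; rewrite -(subrK y x) -addrA; exact: J_add. Qed.

Lemma congM x x' y y' : x ≡ x' -> y ≡ y' -> x * y ≡ x' * y'.
Proof.
move=> xx yy; apply: (@cong_trans (x' * y)).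
  by rewrite -mulrBl; exact: J_mulr.
by rewrite -mulrBr; exact: J_mull.
Qed.

Lemma cong_sum (I : Type) (s : seq I) (f g : I -> R) :
  (forall i, f i ≡ g i) -> \sum_(i <- s) f i ≡ \sum_(i <- s) g i.
Proof.
by move=> fg; rewrite -sumrB; elim/big_rec: _ => // i x _; exact: J_add.
Qed.

Local Notation q := #|F|.

(** Allows identities of F[X] to be transported to [R] by evaluation at x. *)
Lemma eval_scalar_comm (x : R) : commr_rmorph (in_alg R) x.
Proof. by move=> c; rewrite /GRing.comm in_algE mulr_algl -scaleSr mulr1. Qed.

Local Notation ev x := (horner_morph (eval_scalar_comm x)).

Lemma expX_shift (x : R) c : (x + c%:A) ^+ q = x ^+ q + c%:A.
Proof.
have [p p_pr pF] := finPcharP F.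
have : ('X + c%:P) ^+ q = 'X^q + c%:P :> {poly F}.
  rewrite exprDn_pchar -?polyC_exp ?expf_card //.
  by rewrite (eq_pnat _ (pchar_poly F)) (card_pprimeChar pF) pnatX pnatE ?pF.
move/(congr1 (ev x)).
by rewrite rmorphXn !rmorphD rmorphXn /= !horner_morphX !horner_morphC.
Qed.

(** Lagrange interpolation: on F, 1 - (X - c)^(q-1) is the indicator of c, so both sides agree at
    all q points, and their degrees are below q. *)
Lemma polyX_sum_idem :
  'X = \sum_(c : F) c *: (1 - ('X - c%:P) ^+ (q - 1)) :> {poly F}.
Proof.
have q1 : (1 < q)%N := finRing_gt1 F.
apply/eqP; rewrite -subr_eq0;
  apply/negPn/negP => /max_poly_roots/(_ _ (enum_uniq F)) h.
suff /h : all (root ('X - \sum_(c : F) c *: (1 - ('X - c%:P) ^+ (q - 1))))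
  (enum F).
  rewrite -cardE ltnNge => /negP; apply.
  apply: leq_trans (size_polyD _ _) _; rewrite geq_max size_polyX q1 size_polyN.
  apply: leq_trans (size_sum _ _ _) _; apply/bigmax_leqP => c _.
  apply: leq_trans (size_scale_leq _ _) _.
  apply: leq_trans (size_polyD _ _) _; rewrite geq_max size_polyN size_poly1.
  by rewrite size_exp_XsubC subn1 prednK ?leqnn ?andbT ltnW.
apply/allP => a _; rewrite /root !hornerE horner_sum (bigD1 a) //= big1.
  by rewrite !hornerE subrr expr0n subn_eq0 leqNgt q1 /= subr0 mulr1 subrr.
move=> c ca; rewrite !hornerE; apply/eqP; rewrite mulf_eq0; apply/orP; right.
rewrite subr_eq0 eq_sym; apply/eqP.
have ac : a - c != 0 by rewrite subr_eq0 eq_sym.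
by apply: (mulIf ac); rewrite -exprSr mul1r subn1 prednK ?expf_card // ltnW.
Qed.

Lemma sum_idem (x : R) : x = \sum_(c : F) c *: (1 - (x - c%:A) ^+ (q - 1)).
Proof.
rewrite -[LHS](horner_morphX (eval_scalar_comm x)) polyX_sum_idem rmorph_sum /=.
apply: eq_bigr => c _.
rewrite -mul_polyC rmorphM rmorphB rmorph1 rmorphXn rmorphB /=.
by rewrite horner_morphX !horner_morphC mulr_algl.
Qed.

Variable S : R -> Prop.
Hypotheses (S_mul : forall x y, S x -> S y -> S (x * y)).
Hypotheses (S_lin : forall c x y, S x -> S y -> S (c *: x + y)) (S1 : S 1).
Hypothesis S_pow : forall x, S x -> x ^+ q ≡ x.

Lemma S_sub x y : S x -> S y -> S (x - y).
Proof. by move=> hx hy; rewrite addrC -scaleN1r; exact: S_lin. Qed.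

Lemma S_exp x n : S x -> S (x ^+ n).
Proof. by move=> hx; elim: n => // n; rewrite exprS; exact: S_mul. Qed.

(** Since q is at least 2, x^q is a multiple of x^2, and x is congruent to x^q. *)
Lemma reduced_mod x : S x -> J (x * x) -> J x.
Proof.
move=> /S_pow/cong_sym hx xx; rewrite -(subrK (x ^+ q) x); apply: J_add => //.
have : (1 < q)%N := finRing_gt1 F; case: q => [|[|n]] // _.
by rewrite 2!exprS mulrA; exact: J_mulr.
Qed.

(** The elements e r (1 - e) and (1 - e) r e have their squares in [J], hence lie in [J]; so e r and
    r e are both congruent to e r e. *)
Lemma idem_central_mod e r : S e -> S r -> e * e ≡ e -> e * r ≡ r * e.
Proof.
move=> Se Sr ee.
have eC : J ((1 - e) * e) by rewrite mulrBl mul1r; exact: cong_sym.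
have eC' : J (e * (1 - e)) by rewrite mulrBr mulr1; exact: cong_sym.
have SC : S (1 - e) by exact: S_sub.
apply: (@cong_trans (e * r * e)).
  rewrite -{1}[e * r]mulr1 -mulrBr; apply: reduced_mod;
    first by do !apply: S_mul.
  have -> : e * r * (1 - e) * (e * r * (1 - e)) = e * r * ((1 - e) * e * (r *
    (1 - e))).
    by rewrite !mulrA.
  by apply: J_mull; apply: J_mulr.
apply: cong_sym; rewrite -{1}[r * e]mul1r -mulrA -mulrBl.
apply: reduced_mod; first by do !apply: S_mul.
have -> : (1 - e) * (r * e) * ((1 - e) * (r * e)) = (1 - e) * r * (e * (1 - e)
  * (r * e)).
  by rewrite !mulrA.
by apply: J_mull; apply: J_mulr.
Qed.

Lemma commutative_mod x y : S x -> S y -> x * y ≡ y * x.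
Proof.
move=> Sx Sy; rewrite [x]sum_idem mulr_suml mulr_sumr; apply: cong_sum => c.
rewrite -scalerAl -scaleSr -scalerBr; apply: J_scale.
have Sz : S (x - c%:A) by rewrite addrC -scaleNr; exact: S_lin.
move: (x - c%:A) Sz => z Sz; set w := z ^+ _.
have -> : (1 - w) * y - y * (1 - w) = y * w - w * y.
  by rewrite mulrBl mulrBr mul1r mulr1 opprB addrC addrA subrK.
apply: cong_sym; apply: idem_central_mod => //; first exact: S_exp.
(* z^(q-1) is idempotent modulo [J]: its square is z^q z^(q-2), congruent to z z^(q-2). *)
have : (1 < q)%N := finRing_gt1 F.
rewrite /w; move: (S_pow Sz); case: q => [|[|n]] // zq _.
rewrite subn1 /= -exprD addnS -addSn exprD.
by rewrite [z ^+ n.+1]exprS; apply: congM => //; exact: cong_refl.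
Qed.
End PowerIdentityCommutative.

(** * Words up to the consequences of x^q = x *)

Section Tags.
Local Notation letter := (gvar 'Z_2).
Local Notation word := (seq letter).
Local Notation tag := (letter * 'Z_2)%type.

Definition deg (w : word) : 'Z_2 := \sum_(v <- w) v.2.

Lemma deg_cons v w : deg (v :: w) = v.2 + deg w. Proof. exact: big_cons. Qed.
Lemma deg_nil : deg [::] = 0. Proof. exact: big_nil. Qed.
Lemma deg_cat u v : deg (u ++ v) = deg u + deg v. Proof. exact: big_cat. Qed.
Lemma deg1 x : deg [:: x] = x.2. Proof. exact: big_seq1. Qed.

Lemma Z2_addxx (s : 'Z_2) : s + s = 0.
Proof. by case: (ord2_cases s) => ->; apply: val_inj. Qed.

Lemma Z2_simp : ((forall s : 'Z_2, (s + s = 0)%R) * (forall s t :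
  'Z_2, (s + (s + t) = t)%R) *
  (forall s : 'Z_2, (s + 0 = s)%R) * (forall s : 'Z_2, (0 + s = s)%R))%type.
Proof.
by do !split=> * ; rewrite ?addrA ?Z2_addxx ?addr0 ?add0r.
Qed.

(* The i-th row of a product of generic matrices has a single nonzero entry, a
   product of entries of the factors: the factor v contributes its entry in the
   row s that is current when v is read, and moves from row s to row s + v.2. *)
Fixpoint tags (s : 'Z_2) (w : word) : seq tag :=
  if w is v :: w' then (v, s) :: tags (s + v.2) w' else [::].

Lemma tags_cat s u v : tags s (u ++ v) = tags s u ++ tags (s + deg u) v.
Proof.
elim: u s => [|x u IH] s /=; first by rewrite deg_nil addr0.
by rewrite IH deg_cons addrA.
Qed.

Lemma tag_split s w x t : (x, t) \in tags s w ->
  exists u v, w = u ++ x :: v /\ s + deg u = t.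
Proof.
elim: w s => // y w IH s /=;
  rewrite in_cons => /predU1P [[<- <-]|/IH [u [v [-> <-]]]].
  by exists [::], w; rewrite deg_nil addr0.
by exists (y :: u), v; rewrite deg_cons addrA.
Qed.

Lemma tags_even s w : ~~ has (fun x : letter => x.2 == 1) w ->
  tags s w = [seq (x, s) | x <- w] /\ deg w = 0.
Proof.
elim: w => [|x w IH] /=; first by rewrite deg_nil.
rewrite negb_or deg_cons; case: (ord2_cases x.2) => -> //= /IH [E ->].
by rewrite !addr0 E.
Qed.

Lemma odd_split w : has (fun x : letter => x.2 == 1) w ->
  exists u v, w = u ++ v /\ deg u = 1.
Proof.
elim: w => // x w IH /=; case: (ord2_cases x.2) => x2; rewrite x2 /=.
  move=> /IH [u [v [-> du]]]; exists (x :: u), v; split=> //.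
  by rewrite deg_cons x2 du add0r.
by move=> _; exists [:: x], w; rewrite deg1 x2.
Qed.

Definition odd_tag (t : 'Z_2) (x : tag) := (x.1.2 == 1) && (x.2 == t).

(** Only odd letters change the row, so they are read alternately in rows s and s + 1, starting with
    s. *)
Lemma tags_balance (s : 'Z_2) w : count (odd_tag s) (tags s w) =
  (count (odd_tag (s + 1)%R) (tags s w) + (deg w == 1%R))%N.
Proof.
elim: w s => [|x w IH] s /=; first by rewrite deg_nil.
rewrite deg_cons; have E t : odd_tag t (x, s) = (x.2 == 1) && (s == t) by [].
rewrite !E eqxx andbT; have -> : (s == s + 1) = false by case: (ord2_cases s)
  => ->.
rewrite andbF add0n; case: (ord2_cases x.2) => -> /=.
  by rewrite !addr0 add0r IH.
have := IH (s + 1); rewrite -addrA Z2_addxx addr0 => ->.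
by case: (ord2_cases (deg w)) => -> /=; rewrite addn0 addnC.
Qed.

Definition wpow n (u : word) : word := flatten (nseq n u).

Lemma wpowSr n u : wpow n.+1 u = wpow n u ++ u.
Proof. by elim: n => [|n IH]; rewrite /wpow /= ?cats0 // -catA -IH. Qed.

Lemma deg_wpow n u : deg u = 0 -> deg (wpow n u) = 0.
Proof.
by move=> du; elim: n => [|n IH]; rewrite ?deg_nil //= deg_cat du add0r.
Qed.

Lemma count_wpow a s n u : deg u = 0 ->
  count a (tags s (wpow n u)) = (n * count a (tags s u))%N.
Proof.
by move=> du; elim: n => [|n IH] //=; rewrite tags_cat count_cat du addr0 IH.
Qed.

Lemma count_tags_cat a s u v :
  count a (tags s (u ++ v)) = (count a (tags s u) + count a (tags (s + deg u)%R
    v))%N.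
Proof. by rewrite tags_cat count_cat. Qed.

Lemma count_tags_cons a s x v :
  count a (tags s (x :: v)) = (a (x, s) + count a (tags (s + x.2)%R v))%N.
Proof. by []. Qed.

Lemma count_tags_nil a s : count a (tags s [::]) = 0%N.
Proof. by []. Qed.

Definition countE := (count_tags_cat, count_tags_cons, count_tags_nil,
  count_wpow).
Definition degE := (deg_cat, deg_cons, deg_nil).

(** * Congruences of words in which even words commute and satisfy u^q = u *)

Section Congruence.
Variables (q : nat) (q1 : (1 < q)%N) (sim : word -> word -> Prop).
Hypotheses (sim_refl : forall u, sim u u)
  (sim_sym : forall u v, sim u v -> sim v u)
  (sim_trans : forall v u w, sim u v -> sim v w -> sim u w)
  (sim_cat : forall u u' v v', sim u u' -> sim v v' -> sim (u ++ v) (u' ++ v')).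
Hypotheses (sim_comm : forall u v, deg u = 0 -> deg v = 0 ->
  sim (u ++ v) (v ++ u))
  (sim_pow : forall u, deg u = 0 -> sim (wpow q u) u).

Lemma sim_catl u v v' : sim v v' -> sim (u ++ v) (u ++ v').
Proof. exact: sim_cat. Qed.

Lemma sim_catr u u' v : sim u u' -> sim (u ++ v) (u' ++ v).
Proof. by move=> h; exact: sim_cat. Qed.

Lemma sim_powl u v : deg u = 0 -> sim (wpow (q - 1) u ++ u ++ v) (u ++ v).
Proof.
by move=> du; rewrite catA -wpowSr subn1 prednK ?(ltnW q1) //;
  apply/sim_catr/sim_pow.
Qed.

Lemma sim_wpow n u v v' : (0 < n)%N -> sim (u ++ v) (u ++ v') ->
  sim (wpow n u ++ v) (wpow n u ++ v').
Proof.
case: n => // n _ h; rewrite wpowSr -!catA; exact: sim_catl.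
Qed.

(* With a = o1 o2, c = o3 o2, w = o1 o2 o3 and w' = o3 o2 o1, commuting o2 o1
   with o2 o3 gives a w ~ a w' and c w ~ c w', while a^(q-1) fixes w and c^(q-1)
   fixes w'. *)
Lemma sim_odd3 o1 o2 o3 : deg o1 = 1 -> deg o2 = 1 -> deg o3 = 1 ->
  sim (o1 ++ o2 ++ o3) (o3 ++ o2 ++ o1).
Proof.
move=> d1 d2 d3.
pose a := o1 ++ o2; pose c := o3 ++ o2.
pose w := o1 ++ o2 ++ o3; pose w' := o3 ++ o2 ++ o1.
have comm : sim ((o2 ++ o1) ++ (o2 ++ o3)) ((o2 ++ o3) ++ (o2 ++ o1)).
  by apply: sim_comm; rewrite deg_cat ?d1 ?d2 ?d3 Z2_addxx.
have aw : sim (a ++ w) (a ++ w').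
  have := sim_catl o1 comm; by rewrite /a /w /w' -!catA.
have cw : sim (c ++ w') (c ++ w).
  have := sim_catl o3 (sim_sym comm); by rewrite /c /w /w' -!catA.
have da : deg a = 0 by rewrite deg_cat d1 d2 Z2_addxx.
have dc : deg c = 0 by rewrite deg_cat d3 d2 Z2_addxx.
have k0 : (0 < q - 1)%N by rewrite subn_gt0.
have aK : sim (wpow (q - 1) a ++ w) w by have := sim_powl o3 da;
  rewrite /a -!catA.
have cK : sim (wpow (q - 1) c ++ w') w' by have := sim_powl o1 dc;
  rewrite /c -!catA.
rewrite -/w -/w'; clearbody a c w w'.
have {}aw := sim_wpow k0 aw; have {}cw := sim_wpow k0 cw.
have wc : sim (wpow (q - 1) c ++ w) w.
  apply: (sim_trans (v := wpow (q - 1) c ++ wpow (q - 1) a ++ w)).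
    exact/sim_catl/sim_sym.
  apply: (sim_trans (v := wpow (q - 1) a ++ wpow (q - 1) c ++ w)).
    by rewrite !catA; apply/sim_catr/sim_comm; exact: deg_wpow.
  apply: (sim_trans (v := wpow (q - 1) a ++ w')).
    by apply/sim_catl/(sim_trans (sim_sym cw)).
  exact: sim_trans (sim_sym aw) aK.
apply: sim_trans (sim_sym wc) _; apply: sim_trans (sim_sym cw) _; exact: cK.
Qed.

(** Write w' = u x v with deg u = 0. An even x commutes past u. For odd x, if v contains an odd
    letter then x begins an even block that commutes past u; if u contains one, u is a product of
    two odd words and [sim_odd3] reverses the three odd factors of u x. *)
Lemma sim_front s x w w' : perm_eq (tags s (x :: w)) (tags s w') ->
  exists2 w'', sim w' (x :: w'') & perm_eq (tags s w') (tags s (x :: w'')).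
Proof.
move=> pw; have : (x, s) \in tags s w' by rewrite -(perm_mem pw) mem_head.
move=> /tag_split [u [v [w'E du]]].
have {}du : deg u = 0 by apply: (addrI s); rewrite du addr0.
case: (ord2_cases x.2) => x2.
  exists (u ++ v); rewrite w'E.
    rewrite -[x :: v]cat1s -[x :: u ++ v]cat1s !catA;
      apply/sim_catr/sim_comm => //.
    by rewrite deg1 x2.
  apply/permP => a; rewrite /= !tags_cat /= x2 du !addr0 !count_cat /=; ring.
have [/odd_split [v1 [v2 [vE dv1]]]|ev] := boolP (has (fun x :
  letter => x.2 == 1) v).
  exists (v1 ++ u ++ v2); rewrite w'E vE.
    rewrite -[x :: v1 ++ u ++ v2]/((x :: v1) ++ u ++ v2) -[x :: v1 ++ v2]/((x
      :: v1) ++ v2).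
    rewrite !catA; apply/sim_catr/sim_comm => //.
    by rewrite deg_cons x2 dv1 Z2_addxx.
  apply/permP => a; rewrite /= !tags_cat /= !tags_cat x2 du dv1 -?addrA
    !Z2_simp !count_cat /= count_cat.
  ring.
have [/odd_split [o1 [o2 [uE d1]]]|eu] := boolP (has (fun x :
  letter => x.2 == 1) u).
  have d2 : deg o2 = 1.
    by apply: (addrI 1); rewrite Z2_addxx -du uE deg_cat d1.
  exists (o2 ++ o1 ++ v); rewrite w'E uE.
    have := sim_catr v (sim_odd3 d1 d2 (etrans (deg1 x) x2)).
    by rewrite -!catA.
  apply/permP => a; rewrite /= !tags_cat /= x2 deg_cat d1 d2 -?addrA !Z2_simp
    !count_cat /=.
  ring.
have [_ dv] := tags_even s ev; have [uE _] := tags_even s eu.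
case: u => [|y u] in w'E du eu uE *; first by exists v; rewrite w'E.
(* Now [x] is the only odd letter. The first letter [y] of [w'] is even and read in row s, whereas
   in [x :: w] only [x] is read in row s. *)
exfalso; move: pw; rewrite w'E => pw.
have cw : ~~ has (fun x : letter => x.2 == 1) w.
  have odd_count t z : count (fun x : tag => x.1.2 == 1) (tags t z) = count
    (fun x : letter => x.2 == 1) z.
    by elim: z t => //= ? ? IH t; rewrite IH.
  move/permP: pw => /(_ (fun x : tag => x.1.2 == 1));
    rewrite !odd_count /= count_cat /= x2 eqxx.
  move: ev eu; rewrite /= negb_or !has_count -!eqn0Ngt => /eqP-> /andP[/negPf->
    /eqP->].
  by case: (count _ w).
have : (y, s) \in tags s (x :: w) by rewrite (perm_mem pw) mem_head.
rewrite /= (tags_even _ cw).1 in_cons => /predU1P [[yx]|/mapP [z _ [_]]].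
  by move: eu; rewrite /= yx x2.
by rewrite x2; case: (ord2_cases s) => ->.
Qed.

(** The multiset of tags is the commutative monomial attached to a word; [sim_front] lets first
    letters be matched and removed one by one. *)
Lemma sim_tags s w w' : perm_eq (tags s w) (tags s w') -> sim w w'.
Proof.
elim: w s w' => [|x w IH] s w' pw.
  by case: w' pw => // y w' /perm_size.
have [w'' sw' pw'] := sim_front pw; apply: sim_trans (sim_sym sw').
rewrite -cat1s -[x :: w'']cat1s; apply/sim_catl/(IH (s + x.2)).
by have := perm_trans pw pw'; rewrite /= perm_cons.
Qed.

(** The word x b x' is replaced by its q-th power, which has the tags of x b^q x' (x x')^(q-1); then
    b^q goes back to b. *)
Lemma sim_insert_pair x x' b : x.2 = 1 -> x'.2 = 1 -> deg b = 0 ->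
  sim (x :: b ++ [:: x']) (x :: b ++ [:: x'] ++ wpow (q - 1) [:: x; x']).
Proof.
move=> hx hx' db.
have dxb : deg (x :: b ++ [:: x']) = 0.
  by rewrite deg_cons deg_cat deg1 hx hx' db !Z2_simp.
have dxx : deg [:: x; x'] = 0 by rewrite deg_cons deg1 hx hx' Z2_simp.
apply: (sim_trans (sim_sym (sim_pow dxb))).
apply: (@sim_trans (x :: wpow q b ++ [:: x'] ++ wpow (q - 1) [:: x; x'])).
  apply: (@sim_tags 0); apply/permP => a; rewrite count_wpow //.
  rewrite !countE // !degE ?deg_wpow // hx hx' db !Z2_simp.
  have : q = (q - 1).+1 by rewrite subn1 prednK // ltnW.
  by move: (q - 1)%N => k ->; ring.
rewrite -cat1s -[x :: b ++ _]cat1s; apply/sim_catl/sim_catr; exact: sim_pow.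
Qed.

Local Notation N w t := (count_mem t (tags 0 w)).

(** Each of the m rounds replaces one y by y^q. *)
Lemma raise_even w y t m : y.2 = 0 -> (y, t) \in tags 0 w ->
  exists w', [/\ sim w w', deg w' = deg w &
    forall u, N w' u = (N w u + (q - 1) * m * ((y, t) == u))%N].
Proof.
move=> y0; elim: m w => [|m IH] w yw.
  by exists w; split=> // u; rewrite muln0 addn0.
have [w1 [s1 d1 N1]] := IH w yw.
have : (y, t) \in tags 0 w1 by rewrite -has_pred1 has_count N1 addn_gt0
  -has_count has_pred1 yw.
case/tag_split => [u [v [w1E du]]]; exists (u ++ wpow q [:: y] ++ v); split.
- apply: sim_trans s1 _; rewrite w1E -[y :: v]cat1s.
  by apply/sim_catl/sim_catr/sim_sym/sim_pow; rewrite deg1.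
- by rewrite -d1 w1E !deg_cat deg_wpow ?deg1 // deg_cons y0.
- move=> x; move: (N1 x); rewrite w1E !tags_cat !count_cat deg_wpow ?deg1 //
    count_wpow ?deg1 //=.
  rewrite -du y0 !Z2_simp => N1x;
    rewrite [RHS](_ : _ = N w x + (q - 1) * m * (((y, deg u)) == x) + (q - 1) *
      ((y, deg u) == x))%N; last by ring.
  rewrite -N1x addn0 .
  have : q = (q - 1).+1 by rewrite subn1 prednK // ltnW.
  by move: (q - 1)%N => k ->; ring.
Qed.

(** By [tags_balance], odd counts in the two rows must grow together. The letters between an x in
    row 0 and an x' in row 1 form an even word, so each round is an instance of
    [sim_insert_pair]. *)
Lemma raise_odd w x x' m : x.2 = 1 -> x'.2 = 1 -> (x, 0) \in tags 0 w ->
  (x', 1) \in tags 0 w ->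
  exists w', [/\ sim w w', deg w' = deg w &
    forall u, N w' u = (N w u + (q - 1) * m * (((x, 0%R) == u) + ((x', 1%R) ==
      u)))%N].
Proof.
move=> hx hx'; elim: m w => [|m IH] w xw x'w.
  by exists w; split=> // u; rewrite muln0 addn0.
have [w1 [s1 d1 N1]] := IH w xw x'w.
have N1_mem u : u \in tags 0 w -> u \in tags 0 w1.
  by rewrite -!has_pred1 !has_count N1 addn_gt0 => ->.
suff [w' [s' d' N']] : exists w', [/\ sim w1 w', deg w' = deg w1 &
    forall u, N w' u = (N w1 u + (q - 1) * (((x, 0%R) == u) + ((x', 1%R) ==
      u)))%N].
  exists w'; split; [exact: sim_trans s1 s'|by rewrite d'|].
  by move=> u; rewrite N' N1; ring.
have /N1_mem := xw; have /N1_mem := x'w; move: w1 {s1 d1 N1 N1_mem} => w1 x'w1.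
case/tag_split => [u [v [w1E]]]; rewrite add0r => du.
have dxx : deg [:: x; x'] = 0 by rewrite deg_cons deg1 hx hx' Z2_simp.
have dxx' : deg [:: x'; x] = 0 by rewrite deg_cons deg1 hx hx' Z2_simp.
rewrite w1E tags_cat mem_cat du /= in_cons hx !Z2_simp in x'w1; rewrite {}w1E.
(* The tag of [x'] lies before that of [x], coincides with it (impossible, the rows differ), or lies
   after it. *)
case/or3P: x'w1 => [||/tag_split [b [c [vE]]]].
- case/tag_split => [a [b [uE]]]; rewrite add0r => da.
  have db : deg b = 0.
    by move: du; rewrite uE deg_cat da deg_cons hx' !Z2_simp.
  exists (a ++ (x' :: b ++ [:: x] ++ wpow (q - 1) [:: x'; x]) ++ v); split.
  + rewrite uE -!catA; apply: sim_catl.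
    have := sim_catr v (sim_insert_pair hx' hx db).
    by rewrite /= -!catA.
  + by rewrite uE !degE ?deg_wpow // da db hx hx' -?addrA !Z2_simp.
  + move=> t; rewrite uE !countE // !degE ?deg_wpow // hx hx' da db -?addrA
      !Z2_simp /=; ring.
- by move/eqP => [].
rewrite -{2}[1]addr0 => /addrI db.
exists (u ++ (x :: b ++ [:: x'] ++ wpow (q - 1) [:: x; x']) ++ c); split.
+ rewrite vE; apply: sim_catl.
  have := sim_catr c (sim_insert_pair hx hx' db).
  by rewrite /= -!catA.
+ by rewrite vE !degE ?deg_wpow // du db hx hx' -?addrA !Z2_simp.
+ move=> t; rewrite vE !countE // !degE ?deg_wpow // hx hx' du db -?addrA
    !Z2_simp /=; ring.
Qed.

(** For q the order of F, the conditions on counts say that the monomials define the same function: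
    l^m = l^n for all l in F exactly when m and n are both zero, or both positive and congruent
    modulo q - 1. *)
Definition same_class w w' := [/\ deg w = deg w',
  forall t, (0 < N w t)%N = (0 < N w' t)%N & forall t, N w t = N w' t %[mod q -
    1]].

Lemma same_class_refl w : same_class w w. Proof. by []. Qed.

Lemma same_class_sym w w' : same_class w w' -> same_class w' w.
Proof. by case=> d p m; split=> // t; rewrite ?p ?m. Qed.

Lemma same_class_trans w1 w2 w3 :
  same_class w1 w2 -> same_class w2 w3 -> same_class w1 w3.
Proof. by case=> d p m [d' p' m']; split=> [|t|t]; rewrite ?d ?p ?m. Qed.

(* The counts of the tags in Z, which serve as pivots, are left uncontrolled. *)
Definition raisable w0 (Z : seq tag) t := forall w m, same_class w0 w ->
  exists w', [/\ sim w w', same_class w0 w', N w' t = (N w t + (q - 1) * m)%N &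
    forall u, u \notin Z -> u != t -> N w' u = N w u].

Lemma raise_class w w' (e : tag -> nat) : deg w' = deg w ->
  (forall u, N w' u = (N w u + (q - 1) * e u)%N) ->
  (forall u, (0 < e u)%N -> u \in tags 0 w) -> same_class w w'.
Proof.
move=> dw Nw' ew; split=> // t; rewrite Nw'.
  rewrite addn_gt0; case: (posnP (N w t)) => // N0; rewrite muln_gt0.
  case: (posnP (e t)) => [|/ew]; first by rewrite andbF.
  by rewrite -has_pred1 has_count N0.
by rewrite mulnC addnC modnMDl.
Qed.

(* N w t and N w' t agree modulo q - 1, so adding q - 1 times the quotient of the
   other count to each makes them equal. *)
Lemma equalize1 w0 Z t w w' : raisable w0 Z t -> same_class w0 w ->
  same_class w0 w' ->
  exists v v', [/\ [/\ sim w v, sim w' v', same_class w0 v & same_class w0 v'],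
    N v t = N v' t & forall u, u \notin Z -> u != t ->
      N v u = N w u /\ N v' u = N w' u].
Proof.
move=> rt cw cw'.
have [v [sv cv Nv Zv]] := rt w (N w' t %/ (q - 1))%N cw.
have [v' [sv' cv' Nv' Zv']] := rt w' (N w t %/ (q - 1))%N cw'.
exists v, v'; split=> //; last by move=> u uZ ut; rewrite Zv ?Zv'.
have [_ _ /(_ t) e] := same_class_trans (same_class_sym cw) cw'.
rewrite Nv Nv' {1}(divn_eq (N w t) (q - 1)) {2}(divn_eq (N w' t) (q - 1)) e;
  ring.
Qed.

(** Raising one tag leaves every other tag outside [Z] unchanged, so equalities already obtained
    survive. *)
Lemma equalize w0 (Z T : seq tag) w w' :
  (forall t, t \in T -> t \notin Z /\ raisable w0 Z t) ->
  same_class w0 w -> same_class w0 w' ->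
  exists v v', [/\ sim w v, sim w' v', same_class w0 v, same_class w0 v' &
    forall t, t \in T -> N v t = N v' t].
Proof.
move=> rT cw cw'; elim: T rT => [|t T IH] rT; first by exists w, w'.
have [u uT|v [v' [sv sv' cv cv' NT]]] := IH.
  by apply: rT; rewrite in_cons uT orbT.
have [tZ rt] := rT t (mem_head _ _).
have [z [z' [[sz sz' cz cz'] zt Nz]]] := equalize1 rt cv cv'.
exists z, z'; split=> // [| |u]; first exact: sim_trans sv sz.
  exact: sim_trans sv' sz'.
rewrite in_cons => /predU1P [-> //|uT].
have [-> //|ut] := eqVneq u t.
have [uZ _] := rT u (@mem_behead _ (t :: T) _ uT).
by have [-> ->] := Nz u uZ ut; exact: NT.
Qed.

Lemma same_class_tags w w' t : same_class w w' ->
  (t \in tags 0 w) = (t \in tags 0 w').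
Proof. by case=> _ p _; rewrite -!has_pred1 !has_count p. Qed.

Lemma raisable_even w0 Z y t : y.2 = 0 -> (y, t) \in tags 0 w0 -> raisable w0 Z
  (y, t).
Proof.
move=> y0 yt w m cw; rewrite (same_class_tags _ cw) in yt.
have [w' [sw dw Nw]] := raise_even m y0 yt; exists w'; split=> //.
- apply: same_class_trans cw (raise_class (e := fun u => m * ((y, t) == u))%N
    dw _ _).
    by move=> u; rewrite Nw mulnA.
  by move=> u; rewrite muln_gt0 lt0b => /andP[_ /eqP<-].
- by rewrite Nw eqxx muln1.
- by move=> u _ ut; rewrite Nw eq_sym (negPf ut) muln0 addn0.
Qed.

(** Raising an odd tag also raises a partner in the other row; the partner is a pivot in [Z], where
    changes are allowed. *)
Lemma raisable_odd w0 (Z : seq tag) x x' : x.2 = 1 -> x'.2 = 1 ->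
  (x, 0) \in tags 0 w0 -> (x', 1) \in tags 0 w0 ->
  ((x', 1) \in Z -> raisable w0 Z (x, 0)) /\ ((x, 0) \in Z -> raisable w0 Z
    (x', 1)).
Proof.
move=> hx hx' xt xt'.
have key w m : same_class w0 w -> exists w', [/\ sim w w', same_class w0 w' &
    forall u, N w' u = (N w u + (q - 1) * m * (((x, 0%R) == u) + ((x', 1%R) ==
      u)))%N].
  move=> cw; have yt := xt; have yt' := xt'.
  rewrite (same_class_tags _ cw) in yt; rewrite (same_class_tags _ cw) in yt'.
  have [w' [sw dw Nw]] := raise_odd m hx hx' yt yt'; exists w'; split=> //.
  apply: same_class_trans cw (raise_class (e := fun u => m * (((x, 0%R) == u) +
    ((x', 1%R) == u)))%N dw _ _).
    by move=> u; rewrite Nw mulnA.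
  move=> u; rewrite muln_gt0 => /andP[_].
  by have [<- //|_] := eqVneq (x, 0) u; have [<- //|] := eqVneq (x', 1) u.
have ne : ((x, 0) == (x', 1) :> tag) = false by apply/eqP => -[].
split=> zZ w m cw; have [w' [sw dw Nw]] := key w m cw; exists w'; split=> //.
- by rewrite Nw eqxx eq_sym ne muln1.
- move=> u uZ ut; rewrite Nw [_ == u]eq_sym (negPf ut) add0n.
  by case: eqVneq uZ => [<-|]; rewrite ?zZ // muln0 addn0.
- by rewrite Nw eqxx ne add0n muln1.
- move=> u uZ ut; rewrite Nw [(x', _) == u]eq_sym (negPf ut) addn0.
  by case: eqVneq uZ => [<-|]; rewrite ?zZ // muln0 addn0.
Qed.

Lemma count_split (a : pred tag) t s :
  count a s = (count a (filter (predC1 t) s) + a t * count_mem t s)%N.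
Proof.
elim: s => [|x s IH] /=; first by rewrite muln0.
by rewrite IH; have [->|xt] := eqVneq x t; rewrite /=; ring.
Qed.

(* The remaining count is forced by [tags_balance]. *)
Lemma sim_eq_but_one w w' (t : tag) : deg w = deg w' -> t.1.2 = 1 -> t.2 = 1 ->
  (forall u, u != t -> N w u = N w' u) -> sim w w'.
Proof.
move=> dw t1 t2 Nw.
have pf : perm_eq (filter (predC1 t) (tags 0 w)) (filter (predC1 t) (tags 0
  w')).
  apply/allP => u _; apply/eqP; rewrite /= !count_filter.
  have [->|ut] := eqVneq u t.
    by rewrite !(@eq_count _ (predI _ _) pred0) ?count_pred0 // => v /=;
      case: eqP.
  rewrite !(@eq_count _ (predI _ _) (pred1 u)) ?Nw // => v /=;
    case: eqP => // ->; by rewrite ut.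
have /permP cf := pf.
have o0 : odd_tag 0 t = false by rewrite /odd_tag t2 andbF.
have o1 : odd_tag 1 t by rewrite /odd_tag t1 t2.
have := tags_balance 0 w; have := tags_balance 0 w'.
have cs a z := count_split a t (tags 0 z).
rewrite !add0r dw (cs (odd_tag 0) w) (cs (odd_tag 1) w) (cs (odd_tag 0) w') (cs
  (odd_tag 1) w').
rewrite !cf o0 o1 !mul0n !mul1n !addn0.
move=> e1 e2; apply: (@sim_tags 0); apply/allP => u _; apply/eqP => /=.
have [->|/Nw //] := eqVneq u t.
by move: e2; rewrite e1 => /addIn/addnI.
Qed.

Lemma sim_class w w' : same_class w w' -> sim w w'.
Proof.
move=> cw; have c0 := same_class_refl w.
pose even := [seq t <- tags 0 w | t.1.2 == 0].
have rE Z t : t \in even -> raisable w Z t.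
  by rewrite mem_filter => /andP[/eqP t0]; case: t t0 => y s /= y0 yt;
    exact: raisable_even.
(* With no odd letter read in row 1, balance leaves at most one in row 0, so the odd counts already
   agree and only even tags are raised. *)
have [/hasP [[x1 s] xt]|no1] := boolP (has (odd_tag 1) (tags 0 w)); last first.
  have [t tE|v [v' [sv sv' cv cv' NE]]] := @equalize w [::] even w w' _ c0 cw.
    by split=> //; exact: rE.
  apply: sim_trans sv (sim_trans _ (sim_sym sv')).
  have vv' := same_class_trans (same_class_sym cv) cv'.
  apply: (@sim_tags 0); apply/allP => -[x s] _; apply/eqP => /=.
  have [xs|xs] := boolP ((x, s) \in tags 0 w); last first.
    have /negPf := xs; rewrite (same_class_tags _ cv) => /negbT/count_memPn ->.
    by move: xs; rewrite (same_class_tags _ cw) (same_class_tags _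
      (same_class_trans (same_class_sym cw) cv')) => /count_memPn ->.
  case: (ord2_cases x.2) => x2; first by apply: NE; rewrite mem_filter x2 eqxx.
  case: (ord2_cases s) => s0; rewrite {}s0 in xs *; last first.
    by case/hasP: no1; exists (x, 1) => //; rewrite /odd_tag x2 !eqxx.
  have le1 z : same_class w z -> N z (x, 0) = 1%N.
    move=> cz; apply/eqP; rewrite eqn_leq -has_count has_pred1
      -(same_class_tags _ cz) xs andbT.
    apply: (@leq_trans (count (odd_tag 0) (tags 0 z))).
      by apply: sub_count => t /eqP->; rewrite /odd_tag x2 !eqxx.
    rewrite tags_balance add0r (_ : count _ _ = 0%N) ?leq_b1 //.
    apply/eqP; rewrite -leqn0 leqNgt -has_count;
      apply: contra no1 => /hasP [t tz ot].
    by apply/hasP; exists t; rewrite ?(same_class_tags _ cz).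
  by rewrite !le1.
rewrite /odd_tag /= => /andP[/eqP h1 /eqP s1]; rewrite {}s1 in xt.
have /hasP [[x0 s0] xt0] : has (odd_tag 0) (tags 0 w).
  rewrite has_count tags_balance add0r addn_gt0 -has_count; apply/orP; left.
  by apply/hasP; exists (x1, 1) => //; rewrite /odd_tag h1 !eqxx.
rewrite /odd_tag /= => /andP[/eqP h0 /eqP s00]; rewrite {}s00 in xt0.
(* The pivots: all other tags are equalized first, then [(x0, 0)] using [(x1, 1)] alone as pivot,
   and the count of [(x1, 1)] is forced by balance. *)
pose Z : seq tag := [:: (x0, 0); (x1, 1)].
have [t|v [v' [sv sv' cv cv' NE]]] := @equalize w Z [seq t <- tags 0 w | t
  \notin Z] w w' _ c0 cw.
  rewrite mem_filter => /andP[tZ tw]; split=> //; case: t tZ tw => x r tZ xs.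
  case: (ord2_cases x.2) => x2; first exact: raisable_even.
  case: (ord2_cases r) => r01; rewrite r01 in xs *.
    by have [h _] := raisable_odd Z x2 h1 xs xt; apply: h;
      rewrite !in_cons eqxx orbT.
  by have [_ h] := raisable_odd Z h0 x2 xt0 xs; apply: h; rewrite in_cons eqxx.
have r0 : raisable w [:: (x1, 1)] (x0, 0).
  by have [h _] := raisable_odd [:: (x1, 1)] h0 h1 xt0 xt; apply: h;
    rewrite mem_head.
have [z [z' [[sz sz' cz cz'] zt Nz]]] := equalize1 r0 cv cv'.
apply: sim_trans sv (sim_trans sz (sim_trans _ (sim_sym (sim_trans sv' sz')))).
have zz' := same_class_trans (same_class_sym cz) cz'.
apply: (@sim_eq_but_one _ _ (x1, 1)) => //; first by case: zz'.
move=> u u1; have [->//|u0] := eqVneq u (x0, 0).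
have uZ : u \notin [:: (x1, 1)] by rewrite mem_seq1.
have [-> ->] := Nz u uZ u0.
have [us|us] := boolP (u \in tags 0 w).
  by apply: NE; rewrite mem_filter us andbT !in_cons negb_or u0 negb_or u1.
have /negPf := us; rewrite (same_class_tags _ cv) => /negbT/count_memPn ->.
by move: us; rewrite (same_class_tags _ cv') => /count_memPn ->.
Qed.

End Congruence.
End Tags.

(** * Monomial functions on matrices *)

(** Artin's argument: subtracting chi_i(x) times the relation at y from the relation at [op x y]
    removes the i-th term. The induction hypothesis gives c_j (chi_j(x) - chi_i(x)) = 0, with x
    chosen to separate i from j. *)
Lemma characters_independent (K : idomainType) (M : Type) (op : M -> M -> M)
    (I : eqType) (chi : I -> M -> K) (s : seq I) (c : I -> K) :
  (forall i x y, chi i (op x y) = chi i x * chi i y) ->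
  (forall i, exists x, chi i x != 0) -> uniq s ->
  {in s &, forall i j, i != j -> exists x, chi i x != chi j x} ->
  (forall x, \sum_(i <- s) c i * chi i x = 0) -> {in s, forall i, c i = 0}.
Proof.
move=> chiM chi1; elim: s c => // i s IH c /= /andP[i_s us] chis c0.
have cs j : j \in s -> c j = 0.
  move=> js; have ij : i != j by apply: contraNneq i_s => ->.
  have [x xij] : exists x, chi i x != chi j x.
    by apply: chis => //; rewrite ?mem_head // in_cons js orbT.
  have : c j * (chi j x - chi i x) = 0.
    apply: (IH (fun k => c k * (chi k x - chi i x))) => //.
      by move=> k l ks ls; apply: chis; rewrite in_cons ?ks ?ls orbT.
    move=> y; have := c0 (op x y); have /(congr1 ( *%R (chi i x))) := c0 y.
    rewrite !big_cons mulr0 mulrDr chiM => e1 e2.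
    have := congr2 (fun a b => a - b) e2 e1; rewrite subrr.
    apply: etrans; rewrite mulrCA opprD addrACA subrr add0r mulr_sumr -sumrB.
    by apply: eq_bigr => k _; rewrite chiM; ring.
  by move/eqP; rewrite mulf_eq0 subr_eq0 [_ == chi i x]eq_sym (negPf xij) orbF
    => /eqP.
move=> j; rewrite in_cons => /predU1P [->|/cs //].
have [x xi] := chi1 i; have := c0 x; rewrite big_cons big_seq big1 ?addr0.
  by move/eqP; rewrite mulf_eq0 (negPf xi) orbF => /eqP.
by move=> k /cs ->; rewrite mul0r.
Qed.

Lemma regroup_sum (K : pzRingType) (V : lmodType K) (T : eqType) (s : seq T)
    (rep : T -> T) (c : T -> K) (f : T -> V) :
  \sum_(x <- s) c x *: f (rep x) =
  \sum_(r <- undup (map rep s)) (\sum_(x <- s | rep x == r) c x) *: f r.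
Proof.
under [RHS]eq_bigr do rewrite scaler_suml.
rewrite (exchange_big_dep predT) //= [LHS]big_seq [RHS]big_seq.
apply: eq_bigr => x xs; under eq_bigl do rewrite eq_sym.
by rewrite -big_filter filter_pred1_uniq ?undup_uniq ?big_seq1 // mem_undup
  map_f.
Qed.

Section MonomialFunctions.
Variable F : finFieldType.
Local Notation letter := (gvar 'Z_2).
Local Notation word := (seq letter).
Local Notation tag := (letter * 'Z_2)%type.
Local Notation N w t := (count_mem t (tags 0 w)).
Local Notation q := #|F|.

Definition monfun (w : word) (A : tag -> F) : F := \prod_(t <- tags 0 w) A t.

Definition generic_mx (A : tag -> F) (v : letter) : 'M[F]_2 :=
  \matrix_(i, j) (if j == i + v.2 then A (v, i) else 0).

Lemma generic_mx_comp A v : generic_mx A v \in component (M2grading F) v.2.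
Proof.
rewrite /= /M2comp; case: (ord2_cases v.2) => v2; rewrite v2 inE !mxE v2 /=.
  by rewrite eqxx.
by rewrite eqxx.
Qed.

Lemma weval_generic A w i j : weval (generic_mx A) w i j =
  if j == i + deg w then \prod_(t <- tags i w) A t else 0.
Proof.
elim: w i j => [|v w IH] i j.
  by rewrite /weval big_nil deg_nil addr0 mxE /= big_nil eq_sym; case: (j == i).
rewrite -cat1s weval_cat mulmx2E !IH /weval big_seq1 !mxE deg_cons big_cons
  addrA.
by case: (ord2_cases (i + v.2)) => -> /=; rewrite mul0r ?addr0 ?add0r;
  case: ifP; rewrite ?mulr0.
Qed.

(** Entry (0, j) of the evaluation at generic matrices collects exactly the words of degree j, which
    lead from row 0 to column j. *)
Lemma graded_identity_monfun (p : freealg1 F 'Z_2) A j :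
  graded_identity (M2grading F) p ->
  \sum_(m <- msupp p | deg m == j) p@_m * monfun m A = 0.
Proof.
case=> _ /(_ _ (generic_mx_comp A)); rewrite geval_peval => /matrixP/(_ 0 j).
rewrite [RHS]mxE; apply: etrans; rewrite /peval summxE big_mkcond;
  apply: eq_bigr => m _.
by rewrite mxE weval_generic add0r eq_sym; case: ifP; rewrite ?mulr0.
Qed.

(** Restricting to tags that occur makes this a boolean, usable in [filter]; for any other tag both
    exponents are 0. *)
Definition same_monfun (w w' : word) := (deg w == deg w') &&
  all (fun t => [forall l : F, l ^+ N w t == l ^+ N w' t]) (tags 0 w ++ tags 0
    w').

Lemma same_monfunP w w' :
  reflect (deg w = deg w' /\ forall t (l :
    F), l ^+ N w t = l ^+ N w' t) (same_monfun w w').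
Proof.
apply: (iffP andP) => [[/eqP dw /allP h]|[-> h]]; split=> //.
  move=> t l; have [/h/forallP/(_ l)/eqP //|] := boolP (t \in tags 0 w ++ tags
    0 w').
  by rewrite mem_cat negb_or => /andP[/count_memPn -> /count_memPn ->].
by apply/allP => t _; apply/forallP => l; rewrite h.
Qed.

(** Since 0^0 = 1, l = 0 detects which tags occur; a generator of the multiplicative group of F, a
    primitive (q-1)-th root of unity, detects the counts modulo q - 1. *)
Lemma same_monfun_class w w' : same_monfun w w' -> same_class q w w'.
Proof.
move=> /same_monfunP [dw h]; split=> // t.
  have /eqP := h t 0; rewrite !expr0n.
  by case: (N w t) (N w' t) => [|n] [|m] //=;
    rewrite ?(oner_eq0, eq_sym 0) ?oner_eq0.
have q1 : (0 < q - 1)%N by rewrite subn_gt0 (finRing_gt1 F).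
have : has (q - 1).-primitive_root (enum (predC1 (0 : F))).
  apply: has_prim_root => //; last first.
  - by rewrite -cardE cardC1 subn1.
  - exact: enum_uniq.
  apply/allP => x; rewrite mem_enum => /= x0; apply/unity_rootP.
  by apply: (mulIf x0); rewrite -exprSr mul1r subn1 prednK ?expf_card // ltnW
    // (finRing_gt1 F).
by case/hasP => g _ pg; apply/eqP; rewrite -(eq_prim_root_expr pg) h.
Qed.

Lemma monfunM w A B : monfun w (fun t => A t * B t) = monfun w A * monfun w B.
Proof. exact: big_split. Qed.

Lemma monfun_neq w w' : deg w = deg w' -> ~~ same_monfun w w' ->
  exists A, monfun w A != monfun w' A.
Proof.
rewrite /same_monfun => -> ; rewrite eqxx /= => /allPn [t _ /forallPn [l ll]].
have E u : monfun u (fun x => if x == t then l else 1) = l ^+ N u t.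
  rewrite /monfun; elim: (tags 0 u) => [|x s IH]; first by rewrite big_nil.
  by rewrite big_cons IH /= exprD; case: eqP; rewrite ?mul1r.
by exists (fun x => if x == t then l else 1); rewrite !E.
Qed.
End MonomialFunctions.

Lemma same_monfun_eq (F : finFieldType) w w' : same_monfun F w w' ->
  monfun (F := F) w =1 monfun w'.
Proof.
move=> ww' B; have [_ cp _] := same_monfun_class ww'.
have /same_monfunP [_ h] := ww'.
rewrite /monfun -prodr_undup_exp_count -[RHS]prodr_undup_exp_count.
rewrite (perm_big (undup (tags 0 w'))) /=; first by apply: eq_bigr => t _;
  rewrite h.
by apply: uniq_perm; rewrite ?undup_uniq // => t;
  rewrite !mem_undup -!has_pred1 !has_count cp.
Qed.

Section RepresentativeWords.
Variables (F : finFieldType) (s : seq (seq (gvar 'Z_2))).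
Local Notation word := (seq (gvar 'Z_2)).

(** A canonical choice, the first word of [s] inducing the same function; the default [w] is not
    reached when [w] is in [s]. *)
Definition class_rep (w : word) : word := head w (filter (same_monfun F w) s).

Lemma class_repE w : w \in s -> same_monfun F w (class_rep w).
Proof.
move=> ws; rewrite /class_rep.
have : w \in filter (same_monfun F w) s.
  by rewrite mem_filter ws andbT; apply/same_monfunP.
have : all (same_monfun F w) (filter (same_monfun F w) s) by exact: filter_all.
by case: filter => //= x r /andP[].
Qed.

Lemma class_rep_eq w w' : w \in s -> same_monfun F w w' ->
  class_rep w = class_rep w'.
Proof.
move=> ws /same_monfunP [dw h]; rewrite /class_rep.
rewrite (@eq_filter _ (same_monfun F w') (same_monfun F w)) => [|u]; last first.
  by apply/same_monfunP/same_monfunP => -[d' h']; split=> [|t l];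
    rewrite ?dw ?h // -?dw -?h.
have : w \in filter (same_monfun F w) s.
  by rewrite mem_filter ws andbT; apply/same_monfunP.
by case: filter.
Qed.
End RepresentativeWords.

Lemma scale_affine (K : pzRingType) (V : lmodType K) (c d e : K) (x y z : V) :
  c *: (d *: x + y) + (e *: x + z) = (c * d + e) *: x + (c *: y + z).
Proof. by rewrite scalerDr scalerA scalerDl addrACA. Qed.

(** * T-ideals containing y^q - y contain all graded identities of the matrix algebra *)

Section IdealOfPowerIdentity.
Variables (F : finFieldType) (I : freealg1 F 'Z_2 -> Prop).
Hypotheses (TI : TGideal I) (I_even : I (id_even F #|F|)).
Local Notation A := (freealg1 F 'Z_2).
Local Notation word := (seq (gvar 'Z_2)).
Local Notation q := #|F|.
Local Notation fa := (@freealg F 'Z_2).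

Lemma freealg_part (p : A) : exists c, p - c%:A \in fa.
Proof.
exists p@_mone; rewrite inE mcoeffB mcoeffZ mcoeffU1 eqxx mulr1 subrr //.
Qed.

(** Splitting off the constant term of x extends absorption from [freealg] to the unital algebra, as
    [I] is a subspace. *)
Lemma TGideal_mull1 (x p : A) : I p -> I (x * p).
Proof.
move=> Ip; have [c hx] := freealg_part x.
rewrite -(subrK c%:A x) addrC mulrDl mulr_algl.
by apply: (TGideal_lin TI) => //; exact: (TGideal_mull TI).
Qed.

Lemma TGideal_mulr1 (p x : A) : I p -> I (p * x).
Proof.
move=> Ip; have [c hx] := freealg_part x.
rewrite -(subrK c%:A x) addrC mulrDr -malg_scaleAr mulr1.
by apply: (TGideal_lin TI) => //; exact: (TGideal_mulr TI).
Qed.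

Lemma I_pow0 (s : A) : s \in @freecomp F 'Z_2 0 -> I (s ^+ q - s).
Proof.
(* Substituting s for y_1 and 0 for every other variable respects degrees. *)
move=> hs; pose a (v : gvar 'Z_2) : A := if v == (0%N, 0) then s else 0.
have ha v : a v \in @freecomp F 'Z_2 v.2.
  by rewrite /a; case: eqP => [->|_] //; exact: freecomp0.
have := TGideal_endo TI (subst_endo ha) I_even.
rewrite /id_even pevalB pevalX ?peval_xvar /a ?eqxx //; exact: malg_scaleAr.
Qed.

(* Adjoining the scalars makes the shifts x - c available in [commutative_mod]. *)
Definition even_hull (x : A) := exists c s, s \in @freecomp F 'Z_2 0 /\ x =
  c%:A + s.

Lemma even_hull_mul x y : even_hull x -> even_hull y -> even_hull (x * y).
Proof.
move=> [c [s [hs ->]]] [d [r [hr ->]]];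
  exists (c * d), (c *: r + (d *: s + s * r)).
split; last first.
  rewrite mulrDl !mulrDr !mulr_algl -malg_scaleAr mulr1 scalerA.
  by rewrite -!addrA.
apply: freecomp_lin => //; apply: freecomp_lin => //.
by have := freecompM hs hr; rewrite addr0.
Qed.

Lemma even_hull_lin c x y : even_hull x -> even_hull y ->
  even_hull (c *: x + y).
Proof.
move=> [d [s [hs ->]]] [e [r [hr ->]]]; exists (c * d + e), (c *: s + r).
split; first exact: freecomp_lin.
exact: scale_affine.
Qed.

Lemma even_hull1 : even_hull 1.
Proof. by exists 1, 0; rewrite freecomp0 scale1r addr0. Qed.

Lemma even_hull_pow x : even_hull x -> I (x ^+ q - x).
Proof.
move=> [c [s [hs ->]]]; rewrite [c%:A + s]addrC expX_shift;
  last exact: malg_scaleAr.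
by rewrite opprD addrACA subrr addr0; exact: I_pow0.
Qed.

Lemma even_hull_mon w : deg w = 0 -> even_hull (mon F w).
Proof.
move=> dw; have [->|w0] := eqVneq w [::]; first by rewrite mon_nil;
  exact: even_hull1.
exists 0, (mon F w); split; last by rewrite scale0r add0r.
by rewrite mon_freecomp w0; apply/eqP.
Qed.

Lemma mon_wpow n w : mon F (wpow n w) = mon F w ^+ n.
Proof. by elim: n => [|n IH]; rewrite ?mon_nil //= mon_cat exprS -IH. Qed.

(** Congruence modulo [I] satisfies the hypotheses of [sim_class]: even words lie in the even hull,
    where [commutative_mod] applies. *)
Lemma same_class_mon w w' : same_class q w w' -> I (mon F w - mon F w').
Proof.
have I0 := TGideal0 TI; have Il := TGideal_lin TI.
apply: (@sim_class q _ (fun w w' => I (mon F w - mon F w'))).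
- exact: finRing_gt1 F.
- by move=> u; rewrite subrr.
- by move=> u v /(Il (-1) _ _)/(_ I0); rewrite addr0 scaleN1r opprB.
- by move=> v u w1 uv /(Il 1 _ _ uv); rewrite scale1r addrA subrK.
- move=> u u' v v' uu vv; rewrite !mon_cat.
  have := Il 1 _ _ (TGideal_mulr1 (mon F v) uu) (TGideal_mull1 (mon F u') vv).
  by rewrite scale1r mulrBl mulrBr addrA subrK.
- move=> u v du dv; rewrite !mon_cat.
  apply: (commutative_mod (@malg_scaleAr F 'Z_2) I0 Il TGideal_mull1
    TGideal_mulr1 even_hull_mul
    even_hull_lin even_hull1 even_hull_pow); exact: even_hull_mon.
- by move=> u du; rewrite mon_wpow; apply/even_hull_pow/even_hull_mon.
Qed.

Lemma I_sum (T : eqType) (s : seq T) (c : T -> F) (f : T -> A) :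
  {in s, forall x, I (f x)} -> I (\sum_(x <- s) c x *: f x).
Proof.
move=> hf; rewrite big_seq; elim/big_rec: _ => [|x p xs Ip];
  first exact: (TGideal0 TI).
by apply: (TGideal_lin TI) => //; exact: hf.
Qed.

(** Modulo [I] each word may be replaced by its representative. The regrouped coefficients form a
    relation between distinct monomial functions, hence vanish. *)
Lemma homogeneous_in_ideal (s : seq word) (c : word -> F) j :
  all (fun w => deg w == j) s ->
  (forall B, \sum_(w <- s) c w * monfun w B = 0) ->
  I (\sum_(w <- s) c w *: mon F w).
Proof.
move=> /allP ds s0; pose rep := class_rep F s.
have repE w : w \in s -> same_monfun F w (rep w) by exact: class_repE.
have -> : \sum_(w <- s) c w *: mon F w = \sum_(w <- s) c w *: (mon F w - mon F
  (rep w))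
    + \sum_(w <- s) c w *: mon F (rep w).
  by rewrite -big_split; apply: eq_bigr => w _; rewrite /= -scalerDr subrK.
rewrite -[X in I (X + _)]scale1r; apply: (TGideal_lin TI).
  by apply: I_sum => w /repE/same_monfun_class; exact: same_class_mon.
rewrite regroup_sum big_seq big1; first exact: (TGideal0 TI).
suff c0 : {in undup (map rep s), forall r, \sum_(x <- s | rep x == r) c x = 0}.
  by move=> r /c0 ->; rewrite scale0r.
apply: (@characters_independent F _ (fun B C t => B t * C t) _ (@monfun F)).
- by move=> w B C; exact: monfunM.
- by move=> w; exists (fun=> 1); rewrite /monfun big1_eq oner_eq0.
- exact: undup_uniq.
- move=> r r'; rewrite !mem_undup => /mapP [w ws ->] /mapP [w' ws' ->] ne.
  have [/same_monfunP [d1 h1] /same_monfunP [d2 h2]] := (repE w ws, repE w'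
    ws').
  apply: monfun_neq; first by rewrite -d1 -d2 (eqP (ds w ws)) (eqP (ds w' ws')).
  apply: contraNN ne => /same_monfunP [d h]; apply/eqP/class_rep_eq => //.
  by apply/same_monfunP; rewrite d1 d -d2; split=> // t l; rewrite h1 h -h2.
move=> B; rewrite -[RHS](s0 B).
(* The same regrouping, in F as a module over itself, turns the hypothesis into the relation between
   representatives. *)
rewrite -(regroup_sum (V := F^o) s rep c (fun w => monfun w B)).
rewrite big_seq [RHS]big_seq; apply: eq_bigr => w /repE/same_monfun_eq ->.
by [].
Qed.

End IdealOfPowerIdentity.

Lemma graded_identity_in_ideal (F : finFieldType) (I : freealg1 F 'Z_2 -> Prop)
    (p : freealg1 F 'Z_2) :
  TGideal I -> I (id_even F #|F|) -> graded_identity (M2grading F) p -> I p.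
Proof.
move=> TI Ie ip.
pose s j := [seq w <- map (fun m : {fmonom gvar 'Z_2} => m :
  seq _) (msupp p) | deg w == j].
pose c w := p@_(FMonom w).
have sE (V : nmodType) j (f : {fmonom gvar 'Z_2} -> V) :
    \sum_(w <- s j) f (FMonom w) = \sum_(m <- msupp p | deg m == j) f m.
  by rewrite big_filter big_map; apply: eq_bigr => m _; rewrite fmK.
have Is j : I (\sum_(w <- s j) c w *: mon F w).
  apply: (homogeneous_in_ideal TI Ie (j := j)); first exact: filter_all.
  move=> B; rewrite -[RHS](graded_identity_monfun B j ip).
  exact: (sE _ j (fun m => p@_m * monfun m B)).
have := TGideal_lin TI 1 (Is 0) (Is 1).
rewrite scale1r !(sE _ _ (fun m => p@_m *: mon F m)) => h.
rewrite (mon_sum p) (bigID (fun m : {fmonom gvar 'Z_2} => deg m == 0)) /=.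
rewrite [X in _ + X](eq_bigl (fun m : {fmonom gvar 'Z_2} => deg m == 1)) // =>
  m.
by case: (ord2_cases (deg m)) => ->.
Qed.

(** * The generators are graded identities; conclusion *)

Lemma id_even_identity (F : finFieldType) :
  graded_identity (M2grading F) (id_even F #|F|).
Proof.
have q0 : (0 < #|F|)%N := ltnW (finRing_gt1 F).
have y0 : yvar F 0 \in @freealg F 'Z_2 := freecomp_freealg (xvar_freecomp _ _
  _).
split=> [|a ha].
  rewrite /id_even addrC -scaleN1r; apply: freealg_lin => //; exact: freealgX.
rewrite geval_peval pevalB pevalX ?peval_xvar; last exact: algS.
by rewrite M2_even ?subrr //; exact: (ha (0%N, 0)).
Qed.

(** Isolates the three properties by which evaluation passes through the second generator, whose
    variables then become arbitrary matrices as in [M2_full]. *)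
Lemma full_expr_morph (R S : pzRingType) (f : R -> S) :
  (forall x y, f (x - y) = f x - f y) -> (forall x y, f (x * y) = f x * f y) ->
  (forall x n, f (x ^+ n) = f x ^+ n) -> forall X Y (n m k : nat),
  f ((X - X ^+ n) * (Y - Y ^+ m) - (X - X ^+ n) * (Y - Y ^+ m) * lie_bracket X
    Y ^+ k) =
  (f X - f X ^+ n) * (f Y - f Y ^+ m) -
    (f X - f X ^+ n) * (f Y - f Y ^+ m) * lie_bracket (f X) (f Y) ^+ k.
Proof.
by move=> fB fM fX X Y n m k; rewrite /lie_bracket !(fB, fM, fX).
Qed.

Lemma id_full_identity (F : finFieldType) : 2%N \in [pchar F] ->
  graded_identity (M2grading F) (id_full F #|F|).
Proof.
move=> char2; have q0 : (0 < #|F|)%N := ltnW (finRing_gt1 F).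
have Xf i : Xvar F i \in @freealg F 'Z_2.
  by rewrite /Xvar -[zvar F i]scale1r; apply: freealg_lin;
    exact: freecomp_freealg (xvar_freecomp _ _ _).
have subf (u v : freealg1 F 'Z_2) : u \in @freealg F 'Z_2 ->
  v \in @freealg F 'Z_2 ->
    u - v \in @freealg F 'Z_2.
  by move=> hu hv; rewrite addrC -scaleN1r; exact: freealg_lin.
split=> [|a ha]; rewrite /id_full.
  have uf : Xvar F 0 - Xvar F 0 ^+ #|F| \in @freealg F 'Z_2.
    by apply: subf => //; exact: freealgX.
  apply: subf; first exact: freealgMr uf.
  exact: freealgMr (freealgMr _ uf).
have mulS := @algS F 'M[F]_2; rewrite geval_peval.
rewrite (full_expr_morph (pevalB _) (pevalM mulS _) (pevalX mulS _));
  exact: M2_full.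
Qed.

Theorem theorem20 (F : finFieldType) (q : nat) (hq : #|F| = q)
    (hchar : (2%N \in [pchar F])%R) :
  forall p : freealg1 F 'Z_2,
    graded_identity (M2grading F) p <->
    TGgenerated (fun s => s = id_even F q \/ s = id_full F q) p.
Proof.
subst q => p; split=> [ip I TI gen | gen].
  by apply: graded_identity_in_ideal ip => //; apply: gen; left.
(* Minimality of the generated T-ideal, applied to the T-ideal of identities. *)
apply: gen; first exact: graded_identity_TGideal.
by move=> s [->|->]; [exact: id_even_identity | exact: id_full_identity].
Qed.
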